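(* Let $K$ be the finite field of characteristic $p$ and order $q$, let $s=\nu_2([K:\mathbb{F}_p])$ be the exponent of the largest power of $2$ dividing $[K:\mathbb{F}_p]$, and let $d$ be an integer with $\gcd(d,q-1)=1$. If the set $\{W_{K,d}(a): a\in K^\times\}$ has exactly three elements and equals $\{0,A,-A\}$ for some $A$, then $|A|\ge p^{2^{s-1}}\sqrt{q}$.
   Context: $\psi_K(x)=\exp(2\pi i\,\mathrm{Tr}_{K/\mathbb{F}_p}(x)/p)$ is the canonical additive character of $K$, and for $a\in K$ the Weil sum is $W_{K,d}(a)=\sum_{x\in K}\psi_K(x^d+ax)$. *)

(* Defs.v *)
From HB Require Import structures.
From mathcomp Require Import all_boot all_order all_algebra all_field.
Set Implicit Arguments. Unset Strict Implicit. Unset Printing Implicit Defensive.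
Import Order.TTheory GRing.Theory Num.Theory.
Local Open Scope ring_scope.

(* [K : F_p] = logn p #|K|, since #|K| = p ^ [K:F_p]. *)
Definition ext_deg (K : finFieldType) (p : nat) : nat := logn p #|K|.

Definition abs_trace (K : finFieldType) (p : nat) (x : K) : K :=
  \sum_(i < ext_deg K p) x ^+ (p ^ i).

Definition trace_res (K : finFieldType) (p : nat) (x : K) : nat :=
  odflt 0%N (omap (@nat_of_ord p)
    [pick k : 'I_p | (k : nat)%:R == abs_trace p x]).

(* exp(2 pi i / p) in algC: p.-root (-1) is exp(i pi / p) (root of -1 with
   minimal nonnegative argument), so its square is exp(2 pi i / p). *)
Definition zeta_p (p : nat) : algC := (p.-root (-1 : algC)) ^+ 2.

Definition psiK (K : finFieldType) (p : nat) (x : K) : algC :=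
  zeta_p p ^+ trace_res p x.

Definition weil_sum (K : finFieldType) (p : nat) (d : int) (a : K) : algC :=
  \sum_(x : K) psiK p (x ^ d + a * x).

(* Main.v *)
Require Import Defs.
From HB Require Import structures.
From mathcomp Require Import all_boot all_order all_algebra all_solvable all_field.
From mathcomp Require Import zify.
Set Implicit Arguments. Unset Strict Implicit. Unset Printing Implicit Defensive.
Import Order.TTheory GRing.Theory Num.Theory.
Local Open Scope ring_scope.

(* Write W(a) for the Weil sum, q = #|K| and n = [K : F_p], and let L range over
   the subfields of K of order p^(2^i), i <= s.

   The sums of W and W^3 over K are q and q^2 N, with N the number of u such that
   (u + 1)^d = u^d + 1; as W takes only the values 0, A, -A this gives A^2 = q N,
     and
   the sums of W and W^2 give that A is an integer dividing q, hence A = +-p^k with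
   2k > n. It therefore suffices to show that x |-> x^d is additive on the
   subfield of order p^(2^s), since then N >= p^(2^s).

   Additivity is propagated along the tower of quadratic extensions. On F_p it
   follows from the rationality of W. Let M/L be a step of the tower, #|L| = Q and
   r = [K : M]. If x^d is additive on L, averaging W_M over the substitutions
   x |-> c x, c in L, shows that W_M / Q is an integer >= -1 (Niho). The
   Mellin transform of W_M at a multiplicative character chi is a product of two
     Gauss
   sums, so by Hasse-Davenport its r-th power is the Mellin transform of W_K at the
   lift of chi, which p Q^r divides because 2k > n. Fourier inversion on M^* then
   gives p | W_M / Q, so W_M >= 0. But the sums of W_M and W_M^2 are #|M| and
   #|M|^2, so W_M is concentrated at one point, and x^d is additive on M. *)

(** * Multiplicities along the orbits of a permutation *)

Lemma sum_count_mem (T : eqType) (s t : seq T) :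
  uniq t -> (\sum_(y <- t) count_mem y s)%N = count (mem t) s.
Proof.
move=> Ut; elim: s => [|z s IHs] /=; first by rewrite big1_eq.
rewrite big_split /= IHs; congr addn; rewrite -(count_uniq_mem z Ut) -sum1_count.
by rewrite [RHS]big_mkcond; apply: eq_bigr => y _; rewrite /= eq_sym; case: eqP.
Qed.

Section Orbits.
Local Open Scope nat_scope.
Variables (T : finType) (f : T -> T).
Hypothesis injf : injective f.

Lemma iter_eq_order x i : (iter i f x == x) = (order f x %| i).
Proof.
have ordK k : iter (k * order f x) f x = x.
  by elim: k => //= k IHk; rewrite mulSn iterD IHk iter_order.
rewrite {1}(divn_eq i (order f x)) addnC iterD ordK /dvdn.
have lt : i %% order f x < order f x by rewrite ltn_pmod ?order_gt0.
apply/eqP/eqP => [|->] //.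
by move/(congr1 (findex f x)); rewrite findex_iter // findex0.
Qed.

Lemma count_traject_mul_order x k y :
  count_mem y (traject f x (k * order f x)) = k * (y \in orbit f x).
Proof.
elim: k => // k IHk; rewrite mulSn trajectD count_cat iter_order // IHk mulSn.
by rewrite -/(orbit f x) count_uniq_mem ?orbit_uniq.
Qed.

(** The admissible [i] are multiples [k * order f x]: such a walk visits each point of the orbit [k]
    times, and multiplicity in [s] is constant along the orbit, so the bound says that [k] is at
    most the multiplicity of [x]. *)
Lemma count_orbit_multiples (s : seq T) x :
    (forall y, count_mem (f y) s = count_mem y s) ->
  count (fun i => (iter i f x == x) &&
     [forall y, count_mem y (traject f x i) <= count_mem y s]) (iota 1 (size s))
  = count_mem x s.
Proof.
move=> fs; set D := order f x; have D_gt0 : 0 < D by apply: order_gt0.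
have orb y : y \in orbit f x -> count_mem y s = count_mem x s.
  by case/trajectP=> i _ ->; elim: i => //= i IHi; rewrite fs.
(* This keeps all these multiples inside [iota 1 (size s)]. *)
have ub : count_mem x s * D <= size s.
  rewrite (leq_trans _ (count_size (mem (orbit f x)) s)) //.
  rewrite -sum_count_mem ?orbit_uniq // (eq_big_seq _ orb) big_const_seq.
  by rewrite count_predT iter_addn_0 size_orbit.
rewrite -size_filter -[RHS](size_iota 1) -(size_map (muln^~ D) (iota 1 _)).
apply: perm_size; apply: uniq_perm.
- by rewrite filter_uniq ?iota_uniq.
- rewrite map_inj_in_uniq ?iota_uniq // => a b _ _ /eqP.
  by rewrite eqn_pmul2r // => /eqP.
move=> i; rewrite mem_filter mem_iota iter_eq_order -/D.
apply/andP/mapP => [[/andP[/dvdnP[k ->] /forallP lek] /andP[k_gt0 lt]]|[k]].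
  exists k => //; rewrite mem_iota add1n ltnS.
  move: (lek x); rewrite count_traject_mul_order -/D /orbit.
  rewrite -/(orbit f x) in_orbit muln1 => ->; rewrite andbT.
  by move: k_gt0; rewrite muln_gt0 => /andP[].
rewrite mem_iota add1n ltnS => /andP[k_gt0 lek] ->.
rewrite dvdn_mull // muln_gt0 k_gt0 D_gt0 add1n ltnS (leq_trans _ ub) ?leq_mul2r
  ?lek ?orbT //.
split=> //; apply/forallP=> y; rewrite count_traject_mul_order.
by case: (boolP (y \in _)) => [/orb->|_]; rewrite ?muln1 ?muln0.
Qed.
End Orbits.

Lemma dvdp_prod_XsubC_count (R : fieldType) (t s : seq R) :
  reflect (forall y, (count_mem y t <= count_mem y s)%N)
    (\prod_(y <- t) ('X - y%:P) %| \prod_(y <- s) ('X - y%:P)).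
Proof.
apply: (iffP idP) => [dvd y|/count_subseqP[u us /(perm_big _) ->]].
  rewrite -[leqRHS]mu_prod_XsubC mup_geq ?monic_neq0 ?monic_prod_XsubC //.
  apply: dvdp_trans dvd; rewrite -mup_geq ?monic_neq0 ?monic_prod_XsubC //.
  by rewrite mu_prod_XsubC.
by have [w /(perm_big _) ->] := perm_to_subseq us; rewrite big_cat dvdp_mulr.
Qed.

(** * Descent along field embeddings, and powers of Frobenius *)

Section Descent.
Variables (F K : finFieldType) (emb : {rmorphism F -> K}).

(* Inverse of emb, with junk value 0 outside the image. *)
Definition descend (y : K) : F := odflt 0 [pick u | emb u == y].

Lemma descend_map u : descend (emb u) = u.
Proof.
rewrite /descend; case: pickP => [v /eqP/fmorph_inj//|/(_ u)].
by rewrite eqxx.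
Qed.

(** With q = [#|F|], [emb] carries X^q - X to the product of all X - [emb u], and this product
    vanishes at [y]. *)
Lemma fixed_in_image (y : K) : y ^+ #|F| = y -> exists u, y = emb u.
Proof.
move=> yq; have /(congr1 (map_poly emb)) := finField_genPoly F.
rewrite rmorphB /= map_polyXn map_polyX => /(congr1 (fun f => f.[y])).
rewrite !hornerE yq subrr rmorph_prod horner_prod => /esym/eqP.
rewrite prodf_seq_eq0 => /hasP[u _ /=].
by rewrite map_polyXsubC !hornerE subr_eq0 => /eqP->; exists u.
Qed.

Lemma map_descend (y : K) : y ^+ #|F| = y -> emb (descend y) = y.
Proof. by move=> /fixed_in_image[u ->]; rewrite descend_map. Qed.

End Descent.

(** The proof of [p \in [pchar R]] is an argument so that the map can carry a ring morphism
    structure. *)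
Definition frobn (R : comNzRingType) p of p \in [pchar R] :=
  fun m (x : R) => x ^+ (p ^ m).

Section FrobeniusPower.
Variables (R : comNzRingType) (p : nat) (pR : p \in [pchar R]) (m : nat).

Local Notation phi := (frobn pR m).

Lemma frobn_additive : zmod_morphism phi.
Proof.
have pn : p.-nat (p ^ m)%N by rewrite pnatX pnat_id ?(pcharf_prime pR).
move=> x y; rewrite /frobn exprDn_pchar ?(eq_pnat _ (pcharf_eq pR)) //.
by rewrite exprNn_pchar ?(eq_pnat _ (pcharf_eq pR)).
Qed.
Lemma frobn_multiplicative : monoid_morphism phi.
Proof. by split=> [|x y]; rewrite /frobn ?expr1n ?exprMn. Qed.
HB.instance Definition _ := GRing.isZmodMorphism.Build R R phi frobn_additive.
HB.instance Definition _ := GRing.isMonoidMorphism.Build R R phi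
  frobn_multiplicative.
End FrobeniusPower.

Definition mult_char (F : finFieldType) (chi : F -> algC) :=
  [/\ chi 0 = 0, chi 1 = 1 & {morph chi : x y / x * y}].
Definition add_char (F : finFieldType) (psi : F -> algC) :=
  [/\ exists u, psi u != 1, psi 0 = 1 & {morph psi : x y / x + y >-> x * y}].

Definition gauss_sum (F : finFieldType) (chi psi : F -> algC) := \sum_x chi x *
  psi x.

(* These are the trace and the norm of K / F only when n = [K : F]. *)
Definition rel_trace (F K : finFieldType) (emb : {rmorphism F -> K}) (n : nat) (x
  : K) : F :=
  descend emb (\sum_(i < n) x ^+ (#|F| ^ i)).
Definition rel_norm (F K : finFieldType) (emb : {rmorphism F -> K}) (n : nat) (x
  : K) : F :=
  descend emb (\prod_(i < n) x ^+ (#|F| ^ i)).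

Definition mon_poly (F : finFieldType) n (v : 'rV[F]_n) : {poly F} := 'X^n +
  rVpoly v.

Lemma size_rVpoly_lt (F : finFieldType) n (v : 'rV[F]_n) : (size (rVpoly v) <
  n.+1)%N.
Proof. by rewrite ltnS size_poly. Qed.

Lemma size_mon_poly (F : finFieldType) n (v : 'rV[F]_n) : size (mon_poly v) = n.+1.
Proof. by rewrite size_polyDl size_polyXn ?size_rVpoly_lt. Qed.

Lemma mon_poly_monic (F : finFieldType) n (v : 'rV[F]_n) : mon_poly v \is monic.
Proof. by rewrite monicE lead_coefDl ?lead_coefXn ?size_polyXn ?size_rVpoly_lt. Qed.

Lemma mon_polyK (F : finFieldType) n (f : {poly F}) : f \is monic -> size f =
  n.+1 ->
  mon_poly (poly_rV (f - 'X^n) : 'rV_n) = f.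
Proof.
move=> fm sf; rewrite /mon_poly poly_rV_K ?subrKC //.
apply/leq_sizeP=> i; rewrite leq_eqVlt => /predU1P[<-|lt].
  by move/monicP: fm; rewrite lead_coefE sf coefB coefXn eqxx => ->; rewrite subrr.
by rewrite coefB coefXn gtn_eqF // nth_default ?sf // subrr.
Qed.

Lemma mon_poly_inv (F : finFieldType) n (v : 'rV[F]_n) : poly_rV (mon_poly v -
  'X^n) = v.
Proof. by rewrite /mon_poly addrC addKr rVpolyK. Qed.

(** * The Hasse-Davenport relation *)

Section Lambda.
Variables (F W : finFieldType) (emb : {rmorphism F -> W}).
Variables (p m : nat) (pW : p \in [pchar W]) (cardF : #|F| = (p ^ m)%N).
Variables (chi psi : F -> algC).
Hypotheses (chiP : mult_char chi) (psiP : add_char psi).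

Local Notation phi := (frobn pW m).
Local Notation "f ^i" := (map_poly emb f) (at level 2, format "f ^i").

(* Minus the coefficient below the leading one, i.e. the sum of the roots. *)
Definition root_sum (f : {poly F}) : F :=
  if (size f <= 1)%N then 0 else - f`_(size f).-2.
Definition root_prod (f : {poly F}) : F := (-1) ^+ (size f).-1 * f`_0.
(** The multiplicative weight of the L-function proof: its L-function is 1 + g T, with g the Gauss
    sum, by [lambda_sum0], [lambda_sum1] and [lambda_sum_eq0]. *)
Definition lambda (f : {poly F}) : algC := chi (root_prod f) * psi (root_sum f).

Lemma root_sum_split (f : {poly F}) s :
  f^i = \prod_(y <- s) ('X - y%:P) -> emb (root_sum f) = \sum_(y <- s) y.
Proof.
move=> Df; have sf : size f = (size s).+1.
  by rewrite -(size_map_poly emb) Df size_prod_XsubC.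
rewrite /root_sum sf ltnS leqn0; case: eqP => [/size0nil->|/eqP s0].
  by rewrite big_nil rmorph0.
by rewrite rmorphN -coef_map Df /= coefPn_prod_XsubC ?opprK.
Qed.

Lemma root_prod_split (f : {poly F}) s :
  f^i = \prod_(y <- s) ('X - y%:P) -> emb (root_prod f) = \prod_(y <- s) y.
Proof.
move=> Df; have sf : size f = (size s).+1.
  by rewrite -(size_map_poly emb) Df size_prod_XsubC.
rewrite /root_prod sf rmorphM rmorph_sign -coef_map Df /= coef0_prod_XsubC.
by rewrite mulrA -expr2 sqrr_sign mul1r.
Qed.

Lemma lambdaM (f g : {poly F}) s t :
    f^i = \prod_(y <- s) ('X - y%:P) -> g^i = \prod_(y <- t) ('X - y%:P) ->
  lambda (f * g) = lambda f * lambda g.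
Proof.
move=> Df Dg; have Dfg : (f * g)^i = \prod_(y <- s ++ t) ('X - y%:P).
  by rewrite rmorphM big_cat /= Df Dg.
have [_ _ chiM] := chiP; have [_ _ psiD] := psiP.
rewrite /lambda.
have -> : root_prod (f * g) = root_prod f * root_prod g.
  apply: (fmorph_inj emb); rewrite [RHS]rmorphM (root_prod_split Dfg).
  by rewrite (root_prod_split Df) (root_prod_split Dg) big_cat.
have -> : root_sum (f * g) = root_sum f + root_sum g.
  apply: (fmorph_inj emb); rewrite [RHS]rmorphD (root_sum_split Dfg).
  by rewrite (root_sum_split Df) (root_sum_split Dg) big_cat.
by rewrite chiM psiD mulrACA.
Qed.

Lemma iter_frobn i x : iter i phi x = x ^+ (#|F| ^ i).
Proof.
elim: i => [|i IHi]; first by rewrite expr1.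
by rewrite iterS IHi /frobn -cardF -exprM -expnSr.
Qed.

Lemma frobn_inj : injective phi.
Proof. exact: fmorph_inj. Qed.

(* The characteristic polynomial over F of an element x of degree dividing i. *)
Definition char_poly_frob i x := map_poly (descend emb) (\prod_(y <- traject phi
  x i) ('X - y%:P)).

(** [phi] permutes the trajectory cyclically, so it fixes the coefficients of the product, which
    therefore descend to [F]. *)
Lemma map_char_poly_frob i x : iter i phi x = x ->
  (char_poly_frob i x)^i = \prod_(y <- traject phi x i) ('X - y%:P).
Proof.
rewrite /char_poly_frob; set P := \prod_(y <- _) _ => fixx.
have descend0 : descend emb 0 = 0 by rewrite -(rmorph0 emb) descend_map.
have fixP : map_poly phi P = P.
  rewrite rmorph_prod /=; under eq_bigr do rewrite map_polyXsubC.
  rewrite -(big_map phi predT (fun y => 'X - y%:P)) /P; apply: perm_big.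
  case: i fixx {P} => // i fixx.
  rewrite (_ : map phi _ = traject phi (phi x) i.+1); last first.
    by elim: (i.+1) (x) => //= k IHk y; rewrite IHk.
  by rewrite trajectSr -iterSr fixx perm_rcons -trajectS perm_refl.
apply/polyP=> k; rewrite coef_map /= coef_map_id0 // map_descend //.
by rewrite cardF -[in RHS]fixP coef_map.
Qed.

(* A root x of f is counted once for each power of its minimal polynomial that
   divides f, hence as many times as its multiplicity. *)
Lemma count_char_poly_divisors (f : {poly F}) s :
    f^i = \prod_(y <- s) ('X - y%:P) ->
  (\sum_(i <- iota 1 (size s)) #|[pred x | (iter i phi x == x)
      && (char_poly_frob i x %| f)%R]| = size s)%N.
Proof.
move=> Df.
(* The coefficients of [f] lie in [F], so [phi] permutes the roots with their multiplicities. *)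
have fs y : count_mem (phi y) s = count_mem y s.
  have Ds : perm_eq (map phi s) s.
    apply: prod_XsubC_eq; rewrite big_map -Df.
    have -> : \prod_(y <- s) ('X - (phi y)%:P) = map_poly phi f^i.
      rewrite Df rmorph_prod /=; apply: eq_bigr => z _.
      by rewrite map_polyXsubC.
    by apply/polyP=> k; rewrite !coef_map /= /frobn -cardF -rmorphXn expf_card.
  move/permP/(_ (pred1 (phi y))): Ds => <-; rewrite count_map.
  by apply: eq_count => z /=; rewrite (inj_eq frobn_inj).
under eq_bigr do rewrite -sum1_card big_mkcond.
rewrite exchange_big /= -[RHS](count_predT s).
rewrite -(@eq_count _ (mem (enum W))) => [|x]; last by rewrite /= mem_enum.
rewrite -sum_count_mem ?enum_uniq // big_enum /=; apply: eq_bigr => x _.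
rewrite -(count_orbit_multiples frobn_inj x fs) -sum1_count [RHS]big_mkcond.
apply: eq_bigr => i _; rewrite inE /= iter_frobn -iter_frobn.
case: eqP => //= fixx; rewrite -(dvdp_map emb) map_char_poly_frob // Df.
by congr (if _ then _ else _); apply/dvdp_prod_XsubC_count/forallP.
Qed.

Variable r : nat.
Hypothesis splits : forall n (v : 'rV[F]_n), (n <= r)%N ->
  exists s, (mon_poly v)^i = \prod_(y <- s) ('X - y%:P).

Definition lambda_sum n := \sum_(v : 'rV[F]_n) lambda (mon_poly v).
(** For [i = r] this becomes the Gauss sum over [K] in [hasse_davenport]: the root product and root
    sum of [char_poly_frob r x] are the norm and trace of [x]. *)
Definition fixed_sum i :=
  \sum_(x | iter i phi x == x) lambda (char_poly_frob i x).

Lemma char_poly_frob_monic i x : iter i phi x = x -> char_poly_frob i x \is monic.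
Proof.
by move=> fixx; rewrite -(map_monic emb) map_char_poly_frob ?monic_prod_XsubC.
Qed.

Lemma size_char_poly_frob i x : iter i phi x = x -> size (char_poly_frob i x) =
  i.+1.
Proof.
move=> fixx; rewrite -(size_map_poly emb) map_char_poly_frob //.
by rewrite size_prod_XsubC size_traject.
Qed.

(** The monic multiples are P g with g monic of degree [n - i], and [splits] makes [lambdaM]
    applicable to the pair. *)
Lemma lambda_sum_multiples n i x : (i <= n <= r)%N -> iter i phi x = x ->
  \sum_(v : 'rV[F]_n | char_poly_frob i x %| mon_poly v) lambda (mon_poly v)
   = lambda (char_poly_frob i x) * lambda_sum (n - i).
Proof.
move=> /andP[le_in le_nr] fixx; set P := char_poly_frob i x.
have Pm : P \is monic by apply: char_poly_frob_monic.
have sP : size P = i.+1 by apply: size_char_poly_frob.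
pose h (w : 'rV[F]_(n - i)) : 'rV[F]_n := poly_rV (P * mon_poly w - 'X^n).
pose h' (v : 'rV[F]_n) : 'rV[F]_(n - i) := poly_rV (mon_poly v %/ P - 'X^(n - i)).
have hE w : mon_poly (h w) = P * mon_poly w.
  apply: mon_polyK; first by rewrite rpredM ?mon_poly_monic.
  rewrite size_monicM ?monic_neq0 ?mon_poly_monic // sP size_mon_poly.
  by rewrite addSn addnS subnKC.
have hK w : h' (h w) = w.
  by rewrite /h' hE mulKp ?monic_neq0 // mon_poly_inv.
rewrite (reindex_onto h h') /= => [|v /divpK DP]; last first.
  rewrite /h /h' mon_polyK.
  - by rewrite mulrC DP mon_poly_inv.
  - by rewrite -(monicMr _ Pm) DP mon_poly_monic.
  by rewrite size_divp ?monic_neq0 // sP size_mon_poly subSn.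
rewrite mulr_sumr; apply: eq_big => w; first by rewrite hK hE eqxx dvdp_mulr.
move=> _; rewrite hE; have [s Ds] := splits w (leq_trans (leq_subr _ _) le_nr).
exact: lambdaM (map_char_poly_frob fixx) Ds.
Qed.

(* Coefficients of the logarithmic derivative of the L-function of lambda. *)
Lemma lambda_sum_rec n : (n <= r)%N ->
  n%:R * lambda_sum n = \sum_(i <- iota 1 n) fixed_sum i * lambda_sum (n - i).
Proof.
move=> le_nr; rewrite mulr_sumr.
(* The factor [n] is the number of pairs (i, x) counted by [count_char_poly_divisors]. *)
transitivity (\sum_(v : 'rV[F]_n) \sum_(i <- iota 1 n) \sum_(x | iter i phi x == x)
   if char_poly_frob i x %| mon_poly v then lambda (mon_poly v) else 0).
  apply: eq_bigr => v _; have [s Ds] := splits v le_nr.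
  have sn : size s = n.
    apply: succn_inj.
    by rewrite -(size_prod_XsubC s id) -Ds size_map_poly size_mon_poly.
  have := count_char_poly_divisors Ds; rewrite sn => {1}<-.
  rewrite natr_sum mulr_suml; apply: eq_bigr => i _.
  rewrite mulr_natl -sumr_const -big_mkcondr; apply: eq_bigl => x.
  by rewrite inE.
rewrite exchange_big /= big_seq [RHS]big_seq; apply: eq_bigr => i.
rewrite mem_iota add1n ltnS => /andP[_ le_in]; rewrite exchange_big mulr_suml /=.
apply: eq_bigr => x /eqP fixx; rewrite -big_mkcond.
by rewrite lambda_sum_multiples ?le_in.
Qed.

Lemma lambda_sum0 : lambda_sum 0 = 1.
Proof.
have [_ chi1 _] := chiP; have [_ psi0 _] := psiP.
rewrite /lambda_sum (big_pred1 0) => [|v]; last by rewrite [v]thinmx0;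
  apply/esym/eqP; rewrite [RHS]thinmx0.
rewrite /lambda /root_sum /root_prod size_mon_poly /= psi0 mulr1.
by rewrite /mon_poly linear0 addr0 !expr0 coefC mulr1.
Qed.

Lemma lambda_sum1 : lambda_sum 1 = gauss_sum chi psi.
Proof.
rewrite /lambda_sum /gauss_sum.
rewrite (reindex (fun c : F => (\row__ - c) : 'rV_1)) /=; last first.
  exists (fun v => - v 0 0) => [c _|v _]; first by rewrite mxE opprK.
  by apply/rowP=> i; rewrite mxE opprK ord1.
apply: eq_bigr => c _; rewrite /lambda /root_sum /root_prod size_mon_poly /=.
rewrite /mon_poly expr1 mulN1r coefD coefX add0r.
by rewrite -[0%N]/(nat_of_ord (0 : 'I_1)) coef_rVpoly_ord mxE opprK.
Qed.

(** For degree at least 2, shifting the subleading coefficient by [- u] leaves the constant one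
    alone and adds [u] to the root sum, so the sum is multiplied by [psi u != 1]. *)
Lemma lambda_sum_eq0 n : (1 < n)%N -> lambda_sum n = 0.
Proof.
case: n => [|[|n]] // _; have [[u psiu] psi0 psiD] := psiP.
pose w : 'rV[F]_n.+2 := - u *: delta_mx 0 ord_max.
have: lambda_sum n.+2 = psi u * lambda_sum n.+2.
  rewrite {1}/lambda_sum (reindex_inj (addIr w)) mulr_sumr /=; apply: eq_bigr =>
    v _.
  have coefw k : (mon_poly (v + w))`_k = (mon_poly v)`_k - u *+ (k == n.+1).
    rewrite /mon_poly linearD linearZ /= rVpoly_delta addrA coefD coefZ coefXn.
    by rewrite mulNr mulr_natr.
  rewrite /lambda /root_sum /root_prod !size_mon_poly /= !coefw /= eqxx subr0.
  by rewrite mulr1n opprB addrC [in RHS]mulrCA -psiD addrC.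
move/eqP; rewrite -subr_eq0 -{1}[lambda_sum _]mul1r -mulrBl mulf_eq0 subr_eq0.
by rewrite eq_sym (negPf psiu) => /eqP.
Qed.

(** For n >= 2 the left side of [lambda_sum_rec] vanishes and only the last two terms on the right
    survive: each step multiplies by minus the Gauss sum. *)
Lemma fixed_sumE n : (0 < n <= r)%N -> fixed_sum n = (-1) ^+ n.-1 * gauss_sum chi
  psi ^+ n.
Proof.
case: n => // n /= lt_nr; elim: n lt_nr => [|n IHn] lt_nr.
  have := lambda_sum_rec lt_nr.
  by rewrite big_seq1 subnn lambda_sum0 lambda_sum1 mul1r mulr1 => <-.
have /esym := lambda_sum_rec lt_nr; rewrite lambda_sum_eq0 // mulr0.
have -> : iota 1 n.+2 = iota 1 n ++ [:: n.+1; n.+2].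
  by rewrite -[in LHS]addn2 iotaD add1n.
rewrite big_cat !big_cons big_nil /= addr0 subnn subSnn lambda_sum0 lambda_sum1
  mulr1.
rewrite big_seq big1 ?add0r => [|i]; last first.
  rewrite mem_iota add1n ltnS => /andP[_ lei].
  rewrite lambda_sum_eq0 ?mulr0 //.
  by rewrite ltn_subRL addn1 ltnS ltnS.
move/eqP; rewrite addrC addr_eq0 => /eqP->; rewrite IHn 1?ltnW //.
by rewrite -mulrA -exprSr !exprS mulN1r !mulNr.
Qed.

End Lambda.

Lemma card_pchar (F : finFieldType) p : p \in [pchar F] -> #|F| = (p ^ logn p
  #|F|)%N.
Proof. by move=> pF; apply: card_pprimeChar pF. Qed.

Lemma finSplittingField (K : finFieldType) (f : {poly K}) : f != 0 ->
  exists (W : finFieldType) (kappa : {rmorphism K -> W}) (s : seq W),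
    map_poly kappa f %= \prod_(y <- s) ('X - y%:P).
Proof.
move=> /FinSplittingFieldFor[L [s Ds _]].
by exists (FinFieldExtType L), (in_alg L), s.
Qed.

Lemma prod_traject (T : Type) (W : comNzRingType) (f : T -> T) (g : T -> W) x n :
  \prod_(y <- traject f x n) g y = \prod_(i < n) g (iter i f x).
Proof.
elim: n x => [|n IHn] x; first by rewrite big_nil big_ord0.
by rewrite big_cons IHn big_ord_recl; congr (_ * _); apply: eq_bigr => i _;
  rewrite -iterSr.
Qed.

Lemma sum_traject (T : Type) (W : nmodType) (f : T -> T) (g : T -> W) x n :
  \sum_(y <- traject f x n) g y = \sum_(i < n) g (iter i f x).
Proof.
elim: n x => [|n IHn] x; first by rewrite big_nil big_ord0.
by rewrite big_cons IHn big_ord_recl; congr (_ + _); apply: eq_bigr => i _;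
  rewrite -iterSr.
Qed.

Section RelTrace.
Variables (F K : finFieldType) (emb : {rmorphism F -> K}) (r : nat).
Hypothesis cardK : #|K| = (#|F| ^ r)%N.

Lemma frob_card_morph : exists phi : {rmorphism K -> K}, forall x, phi x = x ^+
  #|F|.
Proof.
have [p p_pr pF] := finPcharP F.
have pK : p \in [pchar K] by rewrite (fmorph_pchar emb).
by exists (frobn pK (logn p #|F|)) => // x; rewrite /= /frobn -(card_pchar pF).
Qed.

(** Raising to the power [#|F|] shifts the conjugates cyclically, as [x ^+ (#|F| ^ r) = x], so their
    sum descends. *)
Lemma map_rel_trace x : emb (rel_trace emb r x) = \sum_(i < r) x ^+ (#|F| ^ i).
Proof.
apply: map_descend; have [phi phiE] := frob_card_morph.
rewrite -phiE rmorph_sum /=; case: (r) cardK => [|n cK]; first by rewrite !big_ord0.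
rewrite big_ord_recr big_ord_recl /= addrC !phiE -exprM -expnSr -cK expf_card.
by rewrite expn0 expr1; congr (_ + _); apply: eq_bigr => i _; rewrite phiE -exprM
  -expnSr.
Qed.

Lemma map_rel_norm x : emb (rel_norm emb r x) = \prod_(i < r) x ^+ (#|F| ^ i).
Proof.
apply: map_descend; have [phi phiE] := frob_card_morph.
rewrite -phiE rmorph_prod /=; case: (r) cardK => [|n cK]; first by rewrite
  !big_ord0.
rewrite big_ord_recr big_ord_recl /= mulrC !phiE -exprM -expnSr -cK expf_card.
by rewrite expn0 expr1; congr (_ * _); apply: eq_bigr => i _; rewrite phiE -exprM
  -expnSr.
Qed.

End RelTrace.

(* All monic polynomials over F of degree at most r are split in a common extension W
   of K; the elements of K are the fixed points of the r-th Frobenius power on W. *)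
Theorem hasse_davenport (F K : finFieldType) (emb : {rmorphism F -> K}) (r : nat)
    (chi psi : F -> algC) :
    mult_char chi -> add_char psi -> (0 < r)%N -> #|K| = (#|F| ^ r)%N ->
  gauss_sum (chi \o rel_norm emb r) (psi \o rel_trace emb r)
    = (-1) ^+ r.-1 * gauss_sum chi psi ^+ r.
Proof.
move=> chiP psiP r_gt0 cardK; have [p p_pr pF] := finPcharP F.
pose f := \prod_(n < r.+1) \prod_(v : 'rV[F]_n) map_poly emb (mon_poly v).
have fm : f \is monic.
  by do 2!apply: rpred_prod => ? _; rewrite map_monic mon_poly_monic.
have [W [kappa [s Ds]]] := finSplittingField (monic_neq0 fm).
pose embW : {rmorphism F -> W} := kappa \o emb.
have pW : p \in [pchar W] by rewrite (fmorph_pchar embW).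
have cardF := card_pchar pF.
have splits n (v : 'rV[F]_n) : (n <= r)%N ->
    exists t, map_poly embW (mon_poly v) = \prod_(y <- t) ('X - y%:P).
  rewrite -ltnS => ltnr; have dvd : map_poly embW (mon_poly v) %| \prod_(y <- s)
    ('X - y%:P).
    rewrite -(eqp_dvdr _ Ds) map_poly_comp dvdp_map /f.
    rewrite (bigD1 (Ordinal ltnr)) //= (bigD1 v) //= dvdp_mulr // dvdp_mulr //.
  have [b] := dvdp_prod_XsubC dvd; rewrite eqp_monic ?map_monic ?mon_poly_monic
    ?monic_prod_XsubC //.
  by move/eqP=> ->; exists (mask b s).
have := fixed_sumE pW cardF chiP psiP splits (n := r); rewrite r_gt0 leqnn => <- //.
have kappaK x : descend kappa (kappa x) = x by apply: descend_map.
rewrite /fixed_sum (reindex_onto kappa (descend kappa)) => [|x /eqP]; last first.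
  by rewrite (iter_frobn _ cardF) -cardK => /map_descend.
rewrite /gauss_sum; apply: eq_big => [x|x _] /=.
  by rewrite kappaK eqxx andbT (iter_frobn _ cardF) -cardK -rmorphXn /= expf_card
    eqxx.
have fixx : iter r (frobn pW (logn p #|F|)) (kappa x) = kappa x.
  by rewrite (iter_frobn _ cardF) -cardK -rmorphXn /= expf_card.
have Dx := map_char_poly_frob embW cardF fixx.
rewrite /lambda; congr (chi _ * psi _); apply: (fmorph_inj embW).
  rewrite (root_prod_split Dx) prod_traject /= (map_rel_norm emb cardK) rmorph_prod.
  by apply: eq_bigr => i _; rewrite (iter_frobn _ cardF) rmorphXn.
rewrite (root_sum_split Dx) sum_traject /= (map_rel_trace emb cardK) rmorph_sum.
by apply: eq_bigr => i _; rewrite (iter_frobn _ cardF) rmorphXn.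
Qed.

Lemma sum_comp_inj (T : finType) (h : T -> T) (g : T -> algC) :
  injective h -> \sum_x g (h x) = \sum_x g x.
Proof. by move=> injh; rewrite [RHS](reindex_inj injh). Qed.

(** * Power moments of Weil sums *)

Section AddChar.
Variables (K : finFieldType) (psi : K -> algC).
Hypothesis psiP : add_char psi.

Lemma add_char0 : psi 0 = 1. Proof. by case: psiP. Qed.
Lemma add_charD : {morph psi : x y / x + y >-> x * y}. Proof. by case: psiP. Qed.

Lemma sum_add_char : \sum_x psi x = 0.
Proof.
have [[u psiu] _ psiD] := psiP; apply/eqP.
have: \sum_x psi x = psi u * \sum_x psi x.
  rewrite {1}(reindex_inj (addIr u)) mulr_sumr.
  by apply: eq_bigr => x _; rewrite psiD mulrC.
move/eqP; rewrite -subr_eq0 -{1}[\sum_x _]mul1r -mulrBl mulf_eq0 subr_eq0.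
by rewrite eq_sym (negPf psiu).
Qed.

Lemma sum_add_charM c : \sum_x psi (c * x) = #|K|%:R *+ (c == 0).
Proof.
have [->|c_neq0] := eqVneq; last by rewrite mulr0n sum_comp_inj ?sum_add_char //;
  apply: mulfI.
by under eq_bigr do rewrite mul0r add_char0; rewrite sumr_const.
Qed.

Lemma sum_add_charMr c : \sum_x psi (x * c) = #|K|%:R *+ (c == 0).
Proof. by under eq_bigr do rewrite mulrC; apply: sum_add_charM. Qed.

Lemma add_charM_trivial c : (forall x, psi (c * x) = 1) -> c = 0.
Proof.
move=> psic; apply/eqP; apply: contraFT (oner_eq0 algC) => c_neq0.
have := sum_add_charM c; rewrite (negPf c_neq0) (eq_bigr _ (fun x _ => psic x)).
rewrite sumr_const => /eqP; rewrite pnatr_eq0 => /eqP K0.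
by have := finNzRing_gt1 K; rewrite K0.
Qed.
End AddChar.

(** A Bezout inverse of [e] modulo [#|K|.-1]; positivity of both exponents covers x = 0. *)
Lemma exists_exp_inverse (K : finFieldType) e : coprime e #|K|.-1 -> (0 < e)%N ->
  exists2 e', (0 < e')%N & forall x : K, x ^+ (e * e') = x.
Proof.
move=> co_e e_gt0; have [u v Duv _] := egcdnP #|K|.-1 e_gt0.
rewrite (eqnP co_e) addn1 in Duv.
have u_gt0 : (0 < u)%N by rewrite lt0n; apply: contra_eq_neq Duv => ->.
exists u => // x.
have [->|x_neq0] := eqVneq x 0; first by rewrite expr0n muln_eq0 !gtn_eqF.
rewrite mulnC Duv exprS mulnC exprM.
suff -> : x ^+ #|K|.-1 = 1 by rewrite expr1n mulr1.
apply: (mulfI x_neq0); rewrite mulr1 -exprS prednK ?expf_card //.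
exact: ltnW (finNzRing_gt1 K).
Qed.

Definition weil (K : finFieldType) (psi : K -> algC) (e : nat) (a : K) : algC :=
  \sum_x psi (x ^+ e + a * x).

Section WeilSum.
Variables (K : finFieldType) (psi : K -> algC) (e e' : nat).
Hypotheses (psiP : add_char psi) (e_gt0 : (0 < e)%N).
Hypothesis expK : forall x : K, x ^+ (e * e') = x.
Local Notation W := (weil psi e).
Local Notation q := #|K|%:R.
Let psi0 := add_char0 psiP.
Let psiD := add_charD psiP.

Lemma exp_cancel : cancel (fun x : K => x ^+ e) (fun x => x ^+ e').
Proof. by move=> x; rewrite -exprM. Qed.

Lemma exp_cancel_inv : cancel (fun x : K => x ^+ e') (fun x => x ^+ e).
Proof. by move=> x; rewrite -exprM mulnC. Qed.

Lemma exp_inj : injective (fun x : K => x ^+ e).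
Proof. exact: can_inj exp_cancel. Qed.

(** If [e] is even, injectivity of the power map forces -1 = 1 in [K]. *)
Lemma exp_opp (x : K) : (- x) ^+ e = - x ^+ e.
Proof.
rewrite exprNn -signr_odd; case: (boolP (odd e)) => [_|even_e]; first by rewrite
  mulN1r.
have /exp_inj N1 : (-1) ^+ e = 1 ^+ e :> K by rewrite -signr_odd (negPf even_e)
  expr1n.
by rewrite -[RHS]mulN1r N1.
Qed.

Lemma weil0 : W 0 = 0.
Proof.
rewrite /weil; under eq_bigr do rewrite mul0r addr0.
by rewrite (sum_comp_inj psi exp_inj) sum_add_char.
Qed.

Lemma weilE a : W a = \sum_x psi (x ^+ e) * psi (a * x).
Proof. by apply: eq_bigr => x _; rewrite psiD. Qed.

Lemma sum_delta (g : K -> algC) c : \sum_x g x * (q *+ (x == c)) = q * g c.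
Proof.
rewrite (bigD1 c) //= eqxx big1 ?addr0 => [|x /negPf->]; last by rewrite mulr0.
by rewrite mulrC.
Qed.

Lemma weil_fourier y : \sum_a W a * psi (- (a * y)) = q * psi (y ^+ e).
Proof.
under eq_bigr => a _ do rewrite weilE mulr_suml.
rewrite exchange_big /= -[RHS](sum_delta (fun x => psi (x ^+ e))).
apply: eq_bigr => x _; rewrite -subr_eq0 -(sum_add_charMr psiP) mulr_sumr.
by apply: eq_bigr => a _; rewrite -mulrA -psiD mulrBr.
Qed.

Lemma sum_weil : \sum_a W a = q.
Proof.
have := weil_fourier 0; rewrite expr0n gtn_eqF // psi0 mulr1 => <-.
by apply: eq_bigr => a _; rewrite mulr0 oppr0 psi0 mulr1.
Qed.

Lemma sum_weil_shift (y : K) : \sum_a W a * psi (a * y) = q * psi (- y ^+ e).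
Proof.
by rewrite -exp_opp -weil_fourier; apply: eq_bigr => a _; rewrite mulrN opprK.
Qed.

Lemma sum_weil2 : \sum_a W a ^+ 2 = q ^+ 2.
Proof.
transitivity (\sum_y psi (y ^+ e) * (q * psi (- y ^+ e))).
  under [RHS]eq_bigr => y _ do rewrite -sum_weil_shift mulr_sumr.
  rewrite exchange_big; apply: eq_bigr => a _; rewrite expr2 [X in _ * X]weilE
    mulr_sumr.
  by apply: eq_bigr => y _; rewrite mulrCA.
under eq_bigr do rewrite mulrCA -psiD subrr psi0 mulr1.
by rewrite sumr_const -[LHS]mulr_natr expr2.
Qed.

(* For y != 0, the substitution x = u y makes the triple sum homogeneous in y ^+ e. *)
Lemma sum_weil3 : \sum_a W a ^+ 3 = q ^+ 2 * #|[pred u : K | (u + 1) ^+ e == u ^+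
  e + 1]|%:R.
Proof.
transitivity (\sum_x \sum_y psi (x ^+ e) * psi (y ^+ e) * (q * psi (- (x + y) ^+
  e))).
  under [RHS]eq_bigr => x _ do under eq_bigr => y _ do rewrite -sum_weil_shift
    mulr_sumr.
  under [RHS]eq_bigr => x _ do rewrite exchange_big.
  rewrite exchange_big; apply: eq_bigr => a _ /=.
  rewrite exprS expr2 mulrC -mulrA {1}weilE mulr_suml; apply: eq_bigr => x _.
  rewrite [X in _ * (X * _)]weilE mulr_suml mulr_sumr; apply: eq_bigr => y _.
  rewrite mulrDr psiD; rewrite -!mulrA; congr (_ * _).
  by rewrite mulrCA; congr (_ * _); rewrite [W a * _]mulrC mulrA.
rewrite exchange_big /= expr2 -mulrA.
transitivity (q * \sum_(y : K) \sum_(x : K) psi (x ^+ e + y ^+ e - (x + y) ^+ e)).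
  rewrite mulr_sumr; apply: eq_bigr => y _; rewrite mulr_sumr; apply: eq_bigr =>
    x _.
  by rewrite mulrCA -!psiD.
congr (_ * _).
transitivity (\sum_(y : K) \sum_(u : K) psi (y ^+ e * (u ^+ e + 1 - (u + 1) ^+ e))).
  apply: eq_bigr => y _; have [->|y_neq0] := eqVneq y 0.
    by apply: eq_bigr => u _; rewrite expr0n gtn_eqF // mul0r !addr0 subrr.
  rewrite (reindex_inj (mulIf y_neq0)); apply: eq_bigr => u _.
  by rewrite -{4}[y]mul1r -mulrDl !exprMn mulrBr mulrDr mulr1 ![y ^+ e * _]mulrC.
rewrite exchange_big /= [RHS]mulr_natr -[RHS]sumr_const [RHS]big_mkcond; apply:
  eq_bigr => u _.
rewrite (sum_comp_inj (fun z => psi (z * (u ^+ e + 1 - (u + 1) ^+ e))) exp_inj).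
by rewrite sum_add_charMr // subr_eq0 inE eq_sym; case: eqP.
Qed.

Lemma weil_ge0_additive : (forall a, 0 <= W a) -> {morph (fun x : K => x ^+ e) :
  x y / x + y}.
Proof.
move=> W_ge0.
have q_neq0 : q != 0 :> algC by rewrite pnatr_eq0 -lt0n ltnW ?finNzRing_gt1.
(* All terms turn out non-negative, so [W] takes only the values 0 and q; as its sum is q, it takes
   the value q at exactly one point [b]. *)
have /eqP W01 : \sum_a W a * (q - W a) = 0.
  under eq_bigr do rewrite mulrBr -expr2.
  by rewrite sumrB -mulr_suml sum_weil sum_weil2 expr2 subrr.
have W_le a : W a <= q.
  by rewrite -sum_weil (bigD1 a) //= lerDl sumr_ge0.
rewrite psumr_eq0 in W01 => [|a _]; last by rewrite mulr_ge0 ?subr_ge0.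
have [b Wb] : exists b, W b != 0.
  apply/existsP; apply: contraNT q_neq0 => /existsPn W0.
  by rewrite -sum_weil big1 // => a _; apply/eqP; have := W0 a; rewrite negbK.
have {Wb} DWb : W b = q.
  have := allP W01 b (mem_index_enum _); rewrite mulf_eq0 (negPf Wb) subr_eq0.
  by move/eqP.
have W0 a : a != b -> W a = 0.
  have /eqP := sum_weil; rewrite (bigD1 b) //= DWb addrC -subr_eq0 addrK.
  rewrite psumr_eq0 => [/allP/(_ a (mem_index_enum _))/implyP imp ab|//].
  by apply/eqP/imp.
(* Fourier inversion of a function concentrated at [b]: the left side is thus an additive character
   in [y]. *)
have psie y : psi (y ^+ e) = psi (- (b * y)).
  apply: (mulfI q_neq0); rewrite -weil_fourier (bigD1 b) //= DWb big1 ?addr0 //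
    => a /W0->.
  exact: mul0r.
(* By nondegeneracy it suffices that [psi] is 1 on all multiples of the defect; the multiplier [z]
   is an e-th power and is absorbed into [x] and [y]. *)
move=> x y /=; apply/eqP; rewrite -subr_eq0; apply/eqP; apply: (add_charM_trivial
  psiP) => z.
rewrite mulrC -[z]exp_cancel_inv; move: (z ^+ e') => t.
have psiN c : psi c * psi (- c) = 1 by rewrite -psiD subrr psi0.
rewrite mulrBr mulrDr -!exprMn psiD -[_ ^+ e + _]opprK.
rewrite -[X in _ = X](psiN ((t * x) ^+ e + (t * y) ^+ e)) opprK; congr (_ * _).
by rewrite psiD !psie -psiD -opprD !mulrDr.
Qed.

End WeilSum.

(** * Multiplicative characters and divisibility *)

(** Substituting X^n in the minimal polynomial of [x ^+ n] gives a monic integral polynomial with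
    root [x]. *)
Lemma Aint_root n x : (0 < n)%N -> x ^+ n \in Aint -> x \in Aint.
Proof.
move=> n_gt0; rewrite /Aint unfold_in; set f := minCpoly _ => fint.
have [h [Df fm] _] := minCpolyP (x ^+ n).
apply: (@root_monic_Aint (f \Po 'X^n)).
- by rewrite /root horner_comp hornerXn; apply: root_minCpoly.
- rewrite monicE lead_coef_comp ?size_polyXn // lead_coefXn expr1n mulr1.
  by rewrite -monicE /f Df map_monic.
by rewrite polyOver_comp // rpredX // polyOverX.
Qed.

Lemma expf_card_pred (F : finFieldType) (x : F) : x != 0 -> x ^+ #|F|.-1 = 1.
Proof.
move=> x_neq0; apply: (mulfI x_neq0).
by rewrite mulr1 -exprS prednK ?expf_card // ltnW // finNzRing_gt1.
Qed.

Lemma card_pred_gt0 (F : finFieldType) : (0 < #|F|.-1)%N.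
Proof. by rewrite -ltnS prednK ?finNzRing_gt1 // ltnW // finNzRing_gt1. Qed.

Lemma fin_prim_root (F : finFieldType) : exists g : F, #|F|.-1.-primitive_root g.
Proof.
have /hasP[g _ gprim] : has #|F|.-1.-primitive_root (enum (predC1 (0 : F))); last
  by exists g.
apply: has_prim_root (enum_uniq _) _; first exact: card_pred_gt0.
  apply/allP=> x; rewrite mem_enum unity_rootE => x_neq0.
  by rewrite expf_card_pred.
by rewrite -cardE cardC1.
Qed.

Section MultChar.
Variable F : finFieldType.
Implicit Type chi : F -> algC.

Lemma mult_charX chi n x : mult_char chi -> (0 < n)%N -> chi (x ^+ n) = chi x ^+ n.
Proof.
case=> _ chi1 chiM; case: n => // n _; elim: n => // n IHn.
by rewrite exprS chiM IHn -exprS.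
Qed.

Lemma mult_charVl chi x : mult_char chi -> x != 0 -> chi x^-1 * chi x = 1.
Proof. by case=> _ chi1 chiM x_neq0; rewrite -chiM mulVf. Qed.

Lemma mult_char_Aint chi x : mult_char chi -> chi x \in Aint.
Proof.
move=> chiP; have [chi0 chi1 _] := chiP.
have [->|x_neq0] := eqVneq x 0; first by rewrite chi0 Aint0.
apply: (@Aint_root #|F|.-1); first exact: card_pred_gt0.
by rewrite -mult_charX ?card_pred_gt0 // expf_card_pred // chi1 Aint1.
Qed.

Lemma sum_mult_char chi : mult_char chi ->
  \sum_x chi x = 0 \/ forall x, x != 0 -> chi x = 1.
Proof.
move=> [chi0 chi1 chiM].
case: (boolP [forall x, (x != 0) ==> (chi x == 1)]) => [/forallP triv|].
  by right=> x x_neq0; have /implyP/(_ x_neq0)/eqP := triv x.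
rewrite negb_forall => /existsP[u]; rewrite negb_imply => /andP[u_neq0 chiu].
left; apply/eqP.
have: \sum_x chi x = chi u * \sum_x chi x.
  rewrite {1}(reindex_inj (mulfI u_neq0)) mulr_sumr.
  by apply: eq_bigr => x _; rewrite chiM.
move/eqP; rewrite -subr_eq0 -{1}[\sum_x _]mul1r -mulrBl mulf_eq0 subr_eq0.
by rewrite eq_sym (negPf chiu).
Qed.

(** The characters send a generator [g] of the unit group to the powers of a primitive root of unity
    [z] of order [#|F|.-1]. The formula is orthogonality: the terms with b != a are vanishing
    geometric sums. *)
Lemma mult_char_inversion : exists chi : 'I_#|F|.-1 -> F -> algC,
  (forall j, mult_char (chi j)) /\
  forall (h : F -> algC) a, a != 0 ->
    #|F|.-1%:R * h a = \sum_j chi j a^-1 * \sum_b chi j b * h b.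
Proof.
set N := #|F|.-1; have N_gt0 : (0 < N)%N by apply: card_pred_gt0.
have [g gprim] := fin_prim_root F; have [z zprim] := C_prim_root_exists N_gt0.
have log_ex (x : F) : x != 0 -> exists i, x = g ^+ i.
  by move=> /expf_card_pred/(prim_rootP gprim)[i ->]; exists i.
pose chi (j : 'I_N) x : algC :=
  if [pick i : 'I_N | g ^+ i == x] is Some i then z ^+ (j * i) else 0.
have chi0 j : chi j 0 = 0.
  rewrite /chi; case: pickP => // i /eqP/(congr1 (fun x => x ^+ N)).
  rewrite exprAC (prim_expr_order gprim) expr1n expr0n gtn_eqF //= => /eqP.
  by rewrite oner_eq0.
have chiE j i : chi j (g ^+ i) = (z ^+ i) ^+ j.
  rewrite /chi; case: pickP => [k /eqP/eqP|/(_ (Ordinal (ltn_pmod i N_gt0)))].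
    rewrite (eq_prim_root_expr gprim) -(eq_prim_root_expr zprim) => /eqP zik.
    by rewrite mulnC exprM zik.
  by rewrite /= (prim_expr_mod gprim) eqxx.
have chiP j : mult_char (chi j).
  split=> // [|x y]; first by rewrite -(expr0 g) chiE expr1n.
  have [->|/log_ex[a ->]] := eqVneq x 0; first by rewrite mul0r chi0 mul0r.
  have [->|/log_ex[b ->]] := eqVneq y 0; first by rewrite mulr0 chi0 mulr0.
  by rewrite -exprD !chiE exprD exprMn.
exists chi; split=> // h a a_neq0.
under eq_bigr do rewrite mulr_sumr.
rewrite exchange_big (bigD1 a) //= [X in _ = _ + X]big1 => [|b ba]; last first.
  have [->|b_neq0] := eqVneq b 0.
    by rewrite big1 // => j _; rewrite chi0 mul0r mulr0.
  have [i Di] : exists i, a^-1 * b = g ^+ i by apply: log_ex; rewrite mulf_neq0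
    ?invr_neq0.
  have chiab j : chi j a^-1 * chi j b = (z ^+ i) ^+ j.
    by have [_ _ chiM] := chiP j; rewrite -chiM Di chiE.
  under eq_bigr => j _ do rewrite mulrA chiab.
  rewrite -mulr_suml; apply/eqP; rewrite mulf_eq0; apply/orP; left.
  have z1 : z ^+ i - 1 != 0.
    rewrite subr_eq0 -(prim_order_dvd zprim) (prim_order_dvd gprim) -Di.
    by apply: contraNN ba => /eqP E; rewrite -(mulVKf a_neq0 b) E mulr1.
  by rewrite -(mulrI_eq0 _ (mulfI z1)) -subrX1 exprAC (prim_expr_order zprim)
    expr1n subrr.
rewrite addr0; under eq_bigr do rewrite mulrA mult_charVl // mul1r.
by rewrite sumr_const card_ord mulr_natl.
Qed.

End MultChar.

Section WeilMultChar.
Variables (K : finFieldType) (psi chi : K -> algC) (e e' : nat).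
Hypotheses (psiP : add_char psi) (chiP : mult_char chi).
Hypotheses (e_gt0 : (0 < e)%N) (e'_gt0 : (0 < e')%N).
Hypothesis expK : forall x : K, x ^+ (e * e') = x.

(* The character y |-> conj (chi (y^(1/e))), as e' inverts e modulo #|K| - 1. *)
Definition dual_char y := chi (y ^+ e')^-1.

Lemma dual_charP : mult_char dual_char.
Proof.
have [chi0 chi1 chiM] := chiP; rewrite /dual_char; split=> [||x y].
- by rewrite expr0n gtn_eqF // invr0.
- by rewrite expr1n invr1.
by rewrite exprMn invfM chiM.
Qed.

(** After expanding [weil], the substitution a := a / x splits the inner sum into [chi x^-1] times a
    Gauss sum. At x = 0 the inner sum is that of [chi], whence the hypothesis. *)
Lemma sum_mult_char_weil : \sum_x chi x = 0 ->
  \sum_a chi a * weil psi e a = gauss_sum chi psi * gauss_sum dual_char psi.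
Proof.
have [chi0 chi1 chiM] := chiP; move=> chi_sum0.
transitivity (\sum_x psi (x ^+ e) * \sum_a chi a * psi (a * x)).
  under eq_bigr => a _ do rewrite (weilE _ psiP) mulr_sumr.
  rewrite exchange_big; apply: eq_bigr => x _; rewrite mulr_sumr.
  by apply: eq_bigr => a _; rewrite mulrCA.
rewrite mulr_sumr -[RHS](sum_comp_inj _ (exp_inj expK)); apply: eq_bigr => x _.
rewrite /dual_char exp_cancel // mulrC [RHS]mulrA; congr (_ * _).
have [->|x_neq0] := eqVneq x 0.
  rewrite invr0 chi0 mulr0 -[RHS]chi_sum0.
  by under eq_bigr do rewrite mulr0 add_char0 // mulr1.
rewrite mulr_suml -[RHS](sum_comp_inj _ (mulIf x_neq0)); apply: eq_bigr => a _.
by rewrite chiM [RHS]mulrAC -[_ * _ * chi x^-1]mulrA [chi x * _]mulrC mult_charVl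
  // mulr1.
Qed.

End WeilMultChar.

Section RelNorm.
Variables (F K : finFieldType) (emb : {rmorphism F -> K}) (r : nat).
Hypotheses (r_gt0 : (0 < r)%N) (cardK : #|K| = (#|F| ^ r)%N).
Local Notation N := (rel_norm emb r).

Lemma map_rel_normE x : emb (N x) = x ^+ (\sum_(i < r) #|F| ^ i).
Proof. by rewrite (map_rel_norm emb cardK) -prodrXr. Qed.

Lemma rel_norm_mult_char chi : mult_char chi -> mult_char (chi \o N).
Proof.
have inj := fmorph_inj emb.
have E_neq0 : (\sum_(i < r) #|F| ^ i != 0)%N.
  by case: r r_gt0 => // n _; rewrite big_ord_recl expn0 add1n.
case=> chi0 chi1 chiM; split=> /= [||x y].
- by rewrite (_ : N 0 = 0) //; apply: inj; rewrite map_rel_normE rmorph0 expr0n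
  (negPf E_neq0).
- by rewrite (_ : N 1 = 1) //; apply: inj; rewrite map_rel_normE rmorph1 expr1n.
by rewrite -chiM; congr chi; apply: inj; rewrite rmorphM /= !map_rel_normE exprMn.
Qed.

Lemma rel_normX x n : N (x ^+ n) = N x ^+ n.
Proof. by apply: (fmorph_inj emb); rewrite rmorphXn /= !map_rel_normE exprAC. Qed.

Lemma rel_normV x : N x^-1 = (N x)^-1.
Proof. by apply: (fmorph_inj emb); rewrite fmorphV /= !map_rel_normE exprVn. Qed.

(** The norm is the power map of exponent ([#|K|] - 1) / ([#|F|] - 1), so it sends a generator of
    the units of [K] to a generator of those of [F]. *)
Lemma rel_norm_surj b : b != 0 -> exists2 x, x != 0 & N x = b.
Proof.
move=> b_neq0; have [g gprim] := fin_prim_root K.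
have g_neq0 : g != 0.
  apply: contra_eq_neq (prim_expr_order gprim) => ->.
  by rewrite expr0n gtn_eqF ?card_pred_gt0 // eq_sym oner_neq0.
have Ng : #|F|.-1.-primitive_root (N g).
  rewrite -(fmorph_primitive_root emb) map_rel_normE.
  have := exp_prim_root gprim (\sum_(i < r) #|F| ^ i).
  have cE : #|K|.-1 = (#|F|.-1 * \sum_(i < r) #|F| ^ i)%N by rewrite cardK
    predn_exp.
  rewrite [X in gcdn _ X]cE gcdnMl cE mulnK //.
  by case: r r_gt0 => // n _; rewrite big_ord_recl expn0 add1n.
have [i ->] := prim_rootP Ng (expf_card_pred b_neq0).
by exists (g ^+ i); rewrite ?expf_neq0 // rel_normX.
Qed.

End RelNorm.

Section SubfieldWeil.
Variables (F K : finFieldType) (emb : {rmorphism F -> K}) (r e e' : nat).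
Variable (psi : F -> algC).
Hypotheses (r_gt0 : (0 < r)%N) (cardK : #|K| = (#|F| ^ r)%N).
Hypotheses (e_gt0 : (0 < e)%N) (e'_gt0 : (0 < e')%N).
Hypothesis expK : forall x : K, x ^+ (e * e') = x.
Local Notation psiK := (psi \o rel_trace emb r).
Hypotheses (psiP : add_char psi) (psiKP : add_char psiK).

Lemma expK_sub x : x ^+ (e * e') = x :> F.
Proof. by apply: (fmorph_inj emb); rewrite rmorphXn /= expK. Qed.

(** Hasse-Davenport applies to both Gauss sums, since [dual_char] commutes with the lift through the
    norm; the two signs cancel. *)
Lemma sum_mult_char_weil_lift chi : mult_char chi -> \sum_x chi x = 0 ->
  (\sum_a chi a * weil psi e a) ^+ r
    = \sum_(a : K) chi (rel_norm emb r a) * weil psiK e a.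
Proof.
move=> chiP chi_sum0.
have chiKP := rel_norm_mult_char emb r_gt0 cardK chiP.
have chiK_sum0 : \sum_x (chi \o rel_norm emb r) x = 0.
  (* The norm is surjective, so a trivial lift would make [chi] trivial. *)
  have [//|triv] := sum_mult_char chiKP.
  move: chi_sum0; rewrite (bigD1 0) //=; have [chi0 _ _] := chiP.
  rewrite (eq_bigr (fun=> 1)) => [|b b_neq0]; last first.
    by have [x x_neq0 <-] := rel_norm_surj emb r_gt0 cardK b_neq0; apply: triv.
  rewrite chi0 add0r sumr_const => /eqP; rewrite pnatr_eq0 cardC1.
  by rewrite gtn_eqF ?card_pred_gt0.
rewrite (sum_mult_char_weil psiKP chiKP expK) //.
rewrite (sum_mult_char_weil psiP chiP expK_sub) //.
have dualP := dual_charP chiP e'_gt0.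
rewrite (hasse_davenport emb chiP psiP r_gt0 cardK).
have -> : gauss_sum (dual_char (chi \o rel_norm emb r) e') psiK
    = gauss_sum (dual_char chi e' \o rel_norm emb r) psiK.
  by apply: eq_bigr => x _; rewrite /dual_char /= rel_normV // rel_normX.
rewrite (hasse_davenport emb dualP psiP r_gt0 cardK).
by rewrite mulrACA -expr2 sqrr_sign mul1r exprMn.
Qed.

(* The auxiliary r-th root of p makes divisibility of r-th powers additive. *)
Lemma weil_sub_divisible (p Q : nat) a :
    prime p -> (p %| Q)%N -> (0 < Q)%N -> #|F| = (Q ^ 2)%N ->
    (forall a : K, weil psiK e a / (p * Q ^ r)%:R \in Aint) ->
  #|F|.-1%:R * weil psi e a / (r.-root p%:R * Q%:R) \in Aint.
Proof.
move=> p_pr pQ Q_gt0 cardF divW.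
have [->|a_neq0] := eqVneq a 0; first by rewrite (weil0 psiP expK_sub) mulr0
  mul0r Aint0.
have [chi [chiP ->//]] := mult_char_inversion F.
rewrite mulr_suml rpred_sum // => j _; rewrite -mulrA rpredM ?mult_char_Aint //.
apply: (Aint_root r_gt0); rewrite expr_div_n exprMn rootCK //.
have [chi_sum0|triv] := sum_mult_char (chiP j).
  rewrite sum_mult_char_weil_lift // -natrX -natrM mulr_suml rpred_sum // => b _.
  by rewrite -mulrA rpredM ?mult_char_Aint.
(* For trivial [chi j] the transform is the full sum of W; p Q^r divides its r-th power Q^(2r)
   because p divides Q. *)
have -> : \sum_b chi j b * weil psi e b = (Q ^ 2)%:R.
  rewrite -cardF -(sum_weil psiP e_gt0); apply: eq_bigr => b _.
  have [->|/triv->] := eqVneq b 0; last by rewrite mul1r.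
  by rewrite (weil0 psiP expK_sub) mulr0.
rewrite -!natrX -natrM -natf_div ?rpred_nat //.
by rewrite expnAC expnS expn1 dvdn_mul // dvdn_exp.
Qed.

End SubfieldWeil.

(** * Niho's argument for a quadratic extension *)

Section RelTraceLinear.
Variables (F K : finFieldType) (emb : {rmorphism F -> K}) (r : nat).
Hypothesis cardK : #|K| = (#|F| ^ r)%N.
Local Notation Tr := (rel_trace emb r).

Lemma rel_traceD : {morph Tr : x y / x + y}.
Proof.
have [phi phiE] := frob_card_morph emb.
have iterE i z : iter i phi z = z ^+ (#|F| ^ i).
  by elim: i => [|i IHi]; rewrite ?expn0 ?expr1 //= IHi phiE -exprM -expnSr.
move=> x y; apply: (fmorph_inj emb); rewrite rmorphD !(map_rel_trace emb cardK)
  -big_split.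
apply: eq_bigr => i _; rewrite -!iterE; elim: (nat_of_ord i) => //= k ->.
by rewrite rmorphD.
Qed.

Lemma expf_card_iter (c : F) i : c ^+ (#|F| ^ i) = c.
Proof. by elim: i => [|i IHi]; rewrite ?expn0 ?expr1 // expnSr exprM IHi
  expf_card. Qed.

Lemma rel_traceZ c x : Tr (emb c * x) = c * Tr x.
Proof.
apply: (fmorph_inj emb); rewrite rmorphM !(map_rel_trace emb cardK) mulr_sumr.
by apply: eq_bigr => i _; rewrite exprMn -rmorphXn expf_card_iter.
Qed.

Lemma rel_trace0 : Tr 0 = 0.
Proof. by rewrite -(mulr0 (emb 0)) rel_traceZ mul0r. Qed.

End RelTraceLinear.

Lemma dvdz_Aint (p : nat) (v : int) :
  (0 < p)%N -> v%:~R / p%:R \in Aint -> (p %| v)%Z.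
Proof.
move=> p_gt0 /Cint_rat_Aint; rewrite rpredM ?rpredV ?rpred_int ?rpred_nat //.
case/(_ isT)/intrP=> u /(canRL (mulfVK _)) Dv; apply/dvdzP; exists u.
apply: (@intr_inj algC); rewrite rmorphM /= -pmulrn; apply: Dv.
by rewrite pnatr_eq0 -lt0n.
Qed.

Section Niho.
Variables (L F : finFieldType) (emb : {rmorphism L -> F}) (r e e' : nat).
Variable psi : L -> algC.
Local Notation Q := #|L|.
Local Notation Tr := (rel_trace emb 2).
Local Notation psiF := (psi \o Tr).
Hypotheses (cardF : #|F| = (Q ^ 2)%N).
Hypothesis e_gt0 : (0 < e)%N.
Hypothesis expK : forall x : F, x ^+ (e * e') = x.
Hypothesis psiP : add_char psi.
Hypothesis psi_exp : forall y, psi (y ^+ e) = psi y.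
Local Notation W := (weil psiF e).

Definition niho_zeros a := #|[pred x : F | Tr (x ^+ e) + Tr (a * x) ^+ e == 0]|.

(** In the sum over substitutions x := c x with c in [L], each c != 0 gives [W a] and c = 0 gives
    Q^2. For fixed x, [psi_exp] makes the phase c^e times Tr(x^e) + Tr(a x)^e, so summing over c
    gives Q or 0. *)
Lemma weil_niho a : Q.-1%:R * W a + (Q ^ 2)%:R = (Q * niho_zeros a)%:R.
Proof.
transitivity (\sum_(c : L) \sum_x psiF ((emb c * x) ^+ e + a * (emb c * x))).
  rewrite [RHS](bigD1 0) //= [RHS]addrC; congr (_ + _); last first.
    rewrite (eq_bigr (fun=> 1)) => [|x _]; first by rewrite sumr_const cardF.
    rewrite rmorph0 mul0r expr0n gtn_eqF // mulr0 addr0 (rel_trace0 emb cardF).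
    exact: add_char0.
  rewrite (eq_bigr (fun=> W a)) => [|c c_neq0].
    by rewrite sumr_const cardC1 mulr_natl.
  rewrite /weil -[RHS](sum_comp_inj _ (mulfI (_ : emb c != 0))) ?fmorph_eq0 //.
rewrite exchange_big /= natrM mulr_natr -sumr_const [RHS]big_mkcond.
apply: eq_bigr => x _; rewrite inE -[RHS]mulrb -(sum_add_charMr psiP).
have expL : forall c : L, c ^+ (e * e') = c.
  by move=> c; apply: (fmorph_inj emb); rewrite rmorphXn /= expK.
rewrite -[RHS](sum_comp_inj _ (exp_inj expL)); apply: eq_bigr => c _.
rewrite (rel_traceD emb cardF) exprMn -rmorphXn (rel_traceZ emb cardF) mulrCA
  (rel_traceZ emb cardF).
by rewrite !(add_charD psiP) mulrDr (add_charD psiP) -exprMn psi_exp.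
Qed.

(** Write [W a] = Q v. By [weil_niho], (Q - 1) v = Z - Q, where Z >= 1 counts x = 0, so v >= -1;
    since p divides v, v = -1 is impossible. *)
Lemma weil_niho_ge0 p a : prime p -> (p %| Q)%N -> (0 < r)%N ->
    W a \in Aint ->
  #|F|.-1%:R * W a / (r.-root p%:R * Q%:R) \in Aint -> 0 <= W a.
Proof.
move=> p_pr pQ r_gt0 intW divW; have Q_gt1 := finNzRing_gt1 L.
have Z_gt0 : (0 < niho_zeros a)%N.
  apply/card_gt0P; exists 0; rewrite inE mulr0 expr0n gtn_eqF // (rel_trace0 emb
    cardF).
  by rewrite expr0n gtn_eqF // addr0.
have := weil_niho a; set Z := niho_zeros a in Z_gt0 * => eqW.
have Q1_neq0 : Q.-1%:R != 0 :> algC by rewrite pnatr_eq0 -lt0n card_pred_gt0.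
have ratW : W a \in Crat.
  rewrite -[W a](mulKf Q1_neq0) -[_ * W a](addrK (Q ^ 2)%:R) eqW.
  by rewrite rpredM ?rpredV ?rpredB ?rpred_nat.
have /intrP[w Dw] := Cint_rat_Aint ratW intW.
have eqw : (Q.-1%:Z * w + (Q ^ 2)%:Z = (Q * Z)%:Z)%R.
  by apply: (@intr_inj algC); rewrite rmorphD rmorphM /= -Dw !pmulrn in eqW *.
have Qw : (Q%:Z %| w)%Z.
  have : (Q%:Z %| Q.-1%:Z * w)%Z.
    rewrite -[_ * w](addrK (Q ^ 2)%:Z) eqw rpredB //.
      by rewrite dvdzE /= dvdn_mulr.
    by rewrite dvdzE /= dvdn_exp.
  rewrite Gauss_dvdzr // coprimezE /= -[X in coprime X](prednK (ltnW Q_gt1)).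
  exact: coprimeSn.
have {Qw} [v Dv] := dvdzP Qw.
have v_ge : -1 <= v.
  have Dv' : Q.-1%:Z * v = Z%:Z - Q%:Z.
    have Q_neq0 : Q%:Z != 0 by rewrite eqz_nat -lt0n ltnW.
    apply: (mulfI Q_neq0); move: eqw; rewrite Dv expnS expn1 !PoszM mulrBr => <-.
    by rewrite addrK mulrA mulrC.
  move: Dv' Z_gt0 Q_gt1; clear; move: #|L| Z v => n z v; nia.
have p_gt0 := prime_gt0 p_pr.
(* The r-th power removes the auxiliary root of [p]; the factor [#|F|.-1] is prime to [p]. *)
have pv : (p%:Z %| v)%Z.
  have : (p%:Z %| (#|F|.-1%:Z * v) ^+ r)%Z.
    apply: dvdz_Aint => //; rewrite -(rootCK r_gt0 p%:R) rmorphXn -expr_div_n.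
    rewrite rpredX //; congr (_ \in Aint): divW; rewrite Dw Dv !rmorphM /= -!pmulrn.
    rewrite invfM mulrA mulrAC mulrA mulfK //.
    by rewrite pnatr_eq0 -lt0n ltnW.
  rewrite !dvdzE abszX abszM /= Euclid_dvdX // r_gt0 andbT Euclid_dvdM //.
  case/orP=> // pF1; have := dvdn_exp (isT : (0 < 2)%N) pQ.
  rewrite -cardF -(prednK (ltnW (finNzRing_gt1 F))) -add1n dvdn_addl // dvdn1.
  by move/eqP=> p1; rewrite p1 in p_pr.
have v_ge0 : 0 <= v.
  case: (v) v_ge pv => // -[|k] //; rewrite dvdzE /= dvdn1 => _ /eqP p1.
  by rewrite p1 in p_pr.
by rewrite Dw Dv rmorphM mulr_ge0 ?ler0z.
Qed.

End Niho.

(** * The canonical additive character *)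

(** The order divides the prime [p]. Order 1 would make [p.-root (-1)] equal to 1, whose p-th power
    is not -1, or to -1, although a root of index above 1 is never negative. *)
Lemma zeta_prim p : prime p -> p.-primitive_root (zeta_p p).
Proof.
move=> p_pr; have p_gt0 := prime_gt0 p_pr; have p_gt1 := prime_gt1 p_pr.
have zp1 : zeta_p p ^+ p = 1 by rewrite /zeta_p exprAC rootCK // sqrrN expr1n.
have [m mprim mp] := prim_order_exists p_gt0 zp1.
case/primeP: p_pr => _ /(_ m mp)/pred2P[m1|mE]; last by rewrite mE in mprim.
have : zeta_p p == 1 by rewrite -(prim_expr_order mprim) m1.
rewrite /zeta_p sqrf_eq1 => /orP[]/eqP root1.
  have := rootCK p_gt0 (-1 : algC); rewrite root1 expr1n => /eqP.
  by rewrite -subr_eq0 opprK -mulr2n pnatr_eq0.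
by have := rootC_lt0 (-1 : algC) p_gt1; rewrite root1 ltrN10.
Qed.

Section CanonicalCharacter.
Variables (F : finFieldType) (p : nat) (pF : p \in [pchar F]).
Let p_pr : prime p := pcharf_prime pF.
Let p_gt0 : (0 < p)%N := prime_gt0 p_pr.
Let cardF : #|F| = (p ^ ext_deg F p)%N := card_pchar pF.

Lemma prime_subfieldP (y : F) : y ^+ p = y -> exists k : nat, y = k%:R.
Proof.
move=> yp; have [|u ->] := @fixed_in_image 'F_p (pPrimeCharType pF) (in_alg
  (pPrimeCharType pF)) y.
  by rewrite card_Fp.
by exists u; rewrite -{1}[u]natr_Zp; apply: (rmorph_nat (in_alg (pPrimeCharType
  pF))).
Qed.

Lemma abs_traceD (x y : F) : abs_trace p (x + y) = abs_trace p x + abs_trace p y.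
Proof.
rewrite -big_split; apply: eq_bigr => i _ /=.
exact: (rmorphD (frobn pF i)).
Qed.

Lemma abs_trace_nat (x : F) : exists k : nat, abs_trace p x = k%:R.
Proof.
apply: prime_subfieldP; have := rmorph_sum (frobn pF 1); rewrite /= /frobn expn1
  => ->.
have n_gt0 : (0 < ext_deg F p)%N.
  by rewrite lt0n; apply: contraTneq (finNzRing_gt1 F) => n0; rewrite cardF n0.
rewrite /abs_trace; case: (ext_deg F p) cardF n_gt0 => // n cF _.
rewrite big_ord_recr big_ord_recl /= addrC -exprM -expnSr -cF expf_card.
by rewrite expn0 expr1; congr (_ + _); apply: eq_bigr => i _; rewrite -exprM
  -expnSr.
Qed.

(** The representative picked by [trace_res] is congruent to [k] modulo [p], and one always exists,
    so the default value never occurs. *)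
Lemma psiK_nat (x : F) k : abs_trace p x = k%:R -> psiK p x = zeta_p p ^+ k.
Proof.
move=> Dx; rewrite /psiK /trace_res; case: pickP => [j /eqP|/(_ (Ordinal
  (ltn_pmod k p_gt0)))] /=.
  rewrite Dx => jk; apply/eqP; rewrite (eq_prim_root_expr (zeta_prim p_pr)).
  apply/eqP; move: (nat_of_ord j) k jk {Dx} => {}j k jk.
  wlog le_kj : j k jk / (k <= j)%N.
    by move=> IH; case/orP: (leq_total k j) => ?; [exact: IH | apply/esym/IH].
  by apply/eqP; rewrite eqn_mod_dvd // (dvdn_pcharf pF) natrB // jk subrr.
by rewrite Dx {2}(divn_eq k p) natrD natrM (pcharf0 pF) mulr0 add0r eqxx.
Qed.

Lemma psiK_Aint (x : F) : psiK p x \in Aint.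
Proof. by rewrite rpredX // (Aint_prim_root (zeta_prim p_pr)). Qed.

Lemma psiK_eq1 (x : F) : psiK p x = 1 -> abs_trace p x = 0.
Proof.
have [k Dx] := abs_trace_nat x; rewrite (psiK_nat Dx) Dx => /eqP.
by rewrite -(prim_order_dvd (zeta_prim p_pr)) (dvdn_pcharf pF) => /eqP.
Qed.

Lemma psiK_add_char : add_char (@psiK F p).
Proof.
split=> [||x y].
(* Otherwise the trace polynomial, nonzero and of degree less than [#|F|], would vanish on all of
   [F]. *)
- apply/existsP; apply: contraTT isT => /existsPn triv.
  pose f : {poly F} := \sum_(i < ext_deg F p) 'X^(p ^ i).
  have p_gt1 := prime_gt1 p_pr.
  have n_gt0 : (0 < ext_deg F p)%N.
    by rewrite lt0n; apply: contraTneq (finNzRing_gt1 F) => n0; rewrite cardF n0.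
  have fn : f != 0.
    apply: contraTneq isT => /(congr1 (fun g : {poly F} => g`_1))/eqP.
    rewrite coef0 coef_sum; case: (ext_deg F p) n_gt0 => // n _.
    rewrite big_ord_recl coefXn eqxx big1 ?addr0 ?oner_eq0 // => i _.
    by rewrite coefXn ltn_eqF // -(expn0 p) ltn_exp2l.
  have sf : (size f <= #|F|)%N.
    rewrite (leq_trans (size_sum _ _ _)) //; apply/bigmax_leqP => i _.
    by rewrite size_polyXn cardF ltn_exp2l.
  have := max_poly_roots fn _ (enum_uniq F); rewrite -cardE ltnNge sf => -> //.
  apply/allP=> x _; rewrite /root horner_sum; apply/eqP.
  under eq_bigr do rewrite hornerXn.
  by apply: psiK_eq1; apply/eqP; rewrite -[_ == _]negbK triv.
- rewrite (@psiK_nat 0 0) // /abs_trace big1 // => i _.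
  by rewrite expr0n expn_eq0 gtn_eqF.
have [[j Dx] [k Dy]] := (abs_trace_nat x, abs_trace_nat y).
by rewrite (psiK_nat Dx) (psiK_nat Dy) -exprD; apply: psiK_nat; rewrite
  abs_traceD Dx Dy natrD.
Qed.

(** An additive power map is a ring endomorphism: it commutes with the trace and fixes the prime
    field. *)
Lemma psiK_exp e : (0 < e)%N -> {morph (fun x : F => x ^+ e) : x y / x + y} ->
  forall x : F, psiK p (x ^+ e) = psiK p x.
Proof.
move=> e_gt0 eD x; have [k Dx] := abs_trace_nat x.
rewrite (psiK_nat Dx); apply: psiK_nat.
have -> : (k%:R : F) = k%:R ^+ e.
  elim: k {Dx} => [|k IHk]; first by rewrite expr0n gtn_eqF.
  by rewrite -natr1 eD expr1n -IHk.
rewrite -Dx (big_morph _ eD (_ : 0 ^+ e = 0)) ?expr0n ?gtn_eqF //.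
by apply: eq_bigr => i _; rewrite exprAC.
Qed.

End CanonicalCharacter.

(** Transitivity of the trace: with n = [ext_deg F p], the exponents j n + i for i < n, j < r run
    over all indices below r n. *)
Lemma psiK_rel_trace (F K : finFieldType) (emb : {rmorphism F -> K}) r p :
    p \in [pchar F] -> (0 < r)%N -> #|K| = (#|F| ^ r)%N ->
  @psiK K p =1 @psiK F p \o rel_trace emb r.
Proof.
move=> pF r_gt0 cardK x; have pK : p \in [pchar K] by rewrite (fmorph_pchar emb).
have [k Dk] := abs_trace_nat pF (rel_trace emb r x).
rewrite /= (psiK_nat pF Dk); apply: (psiK_nat pK).
rewrite -(rmorph_nat emb) -Dk /abs_trace rmorph_sum /=.
have cF := card_pchar pF; have p_gt1 := prime_gt1 (pcharf_prime pF).
have -> : ext_deg K p = (r * ext_deg F p)%N.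
  by rewrite /ext_deg cardK {1}cF -expnM pfactorK ?(pcharf_prime pF) // mulnC.
have sumX i (g : 'I_r -> K) : (\sum_j g j) ^+ (p ^ i) = \sum_j g j ^+ (p ^ i).
  exact: (rmorph_sum (frobn pK i)).
under [RHS]eq_bigr => i _.
  rewrite rmorphXn /= (map_rel_trace emb cardK).
  rewrite sumX.
  under eq_bigr => j _ do rewrite -exprM cF -/(ext_deg F p) -expnM -expnD.
  over.
rewrite exchange_big /= -(big_mkord xpredT (fun k => x ^+ (p ^ k))).
rewrite big_nat_mul big_mkord; apply: eq_bigr => j _.
rewrite -{1}[(j * _)%N]add0n big_addn mulSn addnK big_mkord.
by apply: eq_bigr => i _; rewrite addnC mulnC.
Qed.

(** * Additivity of the power map along the tower of subfields *)

(** X^(p^m) - X divides X^[#|K|] - X, a product of distinct linear factors, so its roots in [K]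
    number p^m. *)
Lemma card_frobn_fixed (K : finFieldType) p m r : p \in [pchar K] -> (0 < m)%N ->
  #|K| = (p ^ (m * r))%N -> #|[pred x : K | x ^+ (p ^ m) == x]| = (p ^ m)%N.
Proof.
move=> pK m_gt0 cardK; set u := (p ^ m)%N.
have u_gt1 : (1 < u)%N by rewrite -(exp1n m) ltn_exp2r // prime_gt1 //
  (pcharf_prime pK).
have XnX n : (0 < n)%N -> 'X^n - 'X = 'X * ('X^(n.-1) - 1) :> {poly K}.
  by move=> n_gt0; rewrite mulrBr mulr1 -exprS prednK.
have dvd : 'X^u - 'X %| \prod_(x : K) ('X - x%:P).
  rewrite -finField_genPoly !XnX ?(ltnW u_gt1) ?(ltnW (finNzRing_gt1 K)) //.
  rewrite dvdp_mul2l ?polyX_eq0 // cardK expnM -/u predn_exp exprM.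
  by rewrite [X in _ %| X]subrX1 dvdp_mulr.
have [b Db] := dvdp_prod_XsubC dvd; set s := mask b _ in Db.
have Us : uniq s by rewrite mask_uniq ?index_enum_uniq.
have sf : size ('X^u - 'X : {poly K}) = u.+1.
  by rewrite size_polyDl size_polyXn // size_polyN size_polyX.
have /eqP := eqp_size Db; rewrite sf size_prod_XsubC eqSS => /eqP us.
rewrite [RHS]us -(card_uniqP Us); apply: eq_card => x.
rewrite inE -root_prod_XsubC -(eqp_root Db) /root !hornerE.
by rewrite subr_eq0.
Qed.

Definition frobn_fixed (K : finFieldType) p (pK : p \in [pchar K]) m : {pred K} :=
  fun x => frobn pK m x == x.

Section FixedField.
Variables (K : finFieldType) (p : nat) (pK : p \in [pchar K]) (m : nat).
Local Notation S := (frobn_fixed pK m).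

Lemma frobn_fixed_divring_closed : divring_closed S.
Proof.
split=> [|x y|x y]; rewrite /frobn_fixed !unfold_in ?rmorph1 //.
  by move=> /eqP fx /eqP fy; rewrite rmorphB /= fx fy.
by move=> /eqP fx /eqP fy; rewrite rmorphM fmorphV /= fx fy.
Qed.
HB.instance Definition _ := GRing.isDivringClosed.Build K S
  frobn_fixed_divring_closed.

Record fixed_field := FixedField { fixed_val : K; _ : fixed_val \in S }.
HB.instance Definition _ := [isSub for fixed_val].
HB.instance Definition _ := [Finite of fixed_field by <:].
HB.instance Definition _ := [SubChoice_isSubComUnitRing of fixed_field by <:].
HB.instance Definition _ := [SubComUnitRing_isSubIntegralDomain of fixed_field by
  <:].
HB.instance Definition _ := [SubIntegralDomain_isSubField of fixed_field by <:].

End FixedField.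

Lemma fixed_subfield (K : finFieldType) p m r : p \in [pchar K] -> (0 < m)%N ->
    #|K| = (p ^ (m * r))%N ->
  exists (F : finFieldType) (emb : {rmorphism F -> K}),
    #|F| = (p ^ m)%N /\ forall x, x ^+ (p ^ m) = x -> exists u, emb u = x.
Proof.
move=> pK m_gt0 cardK.
exists (fixed_field pK m : finFieldType), (val : {rmorphism fixed_field pK m -> K}).
split=> [|x /eqP fx]; last by exists (FixedField (fx : x \in frobn_fixed pK m)).
by rewrite card_sub -[RHS](card_frobn_fixed pK m_gt0 cardK).
Qed.

Lemma eq_add_char (F : finFieldType) (psi psi' : F -> algC) :
  psi =1 psi' -> add_char psi -> add_char psi'.
Proof.
move=> eq_psi [[u psiu] psi0 psiD]; split=> [||x y]; rewrite -?eq_psi ?psiD //.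
by exists u; rewrite -eq_psi.
Qed.

Lemma eq_weil (F : finFieldType) (psi psi' : F -> algC) e a :
  psi =1 psi' -> weil psi e a = weil psi' e a.
Proof. by move=> eq_psi; apply: eq_bigr => x _; apply: eq_psi. Qed.

Lemma weil_Aint (F : finFieldType) p e (a : F) : p \in [pchar F] -> weil (@psiK F
  p) e a \in Aint.
Proof. by move=> pF; apply: rpred_sum => x _; apply: psiK_Aint. Qed.

(** Subfields appear here as fixed points inside [K], so that the induction along the tower needs no
    change of type. *)
Definition additive_on_fixed (K : finFieldType) (p e m : nat) := forall x y : K,
  x ^+ (p ^ m) = x -> y ^+ (p ^ m) = y -> (x + y) ^+ e = x ^+ e + y ^+ e.

Section Step.
Variables (K : finFieldType) (p e e' : nat) (pK : p \in [pchar K]).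
Hypotheses (e_gt0 : (0 < e)%N) (e'_gt0 : (0 < e')%N).
Hypothesis expK : forall x : K, x ^+ (e * e') = x.

(** [L] and [F] have orders p^m and p^(2m). Additivity on [L] gives the invariance of [psi] that
    Niho's argument needs, [divW] descends to [F] by [weil_sub_divisible], and non-negativity on [F]
    gives additivity there. *)
Lemma additive_on_fixed_double m r : (0 < m)%N -> (0 < r)%N ->
    #|K| = (p ^ (m.*2 * r))%N ->
    (forall a, weil (@psiK K p) e a / (p * (p ^ m) ^ r)%:R \in Aint) ->
  additive_on_fixed K p e m -> additive_on_fixed K p e m.*2.
Proof.
move=> m_gt0 r_gt0 cardK divW addL; have p_pr := pcharf_prime pK.
have m2_gt0 : (0 < m.*2)%N by rewrite double_gt0.
have [F [embF [cardF fixF]]] := fixed_subfield pK m2_gt0 cardK.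
have pF : p \in [pchar F] by rewrite -(fmorph_pchar embF).
have [|L [embL [cardL _]]] := @fixed_subfield F p m 2 pF m_gt0; first by rewrite
  muln2.
have pL : p \in [pchar L] by rewrite -(fmorph_pchar embL).
have cardFL : #|F| = (#|L| ^ 2)%N by rewrite cardF cardL -expnM muln2.
have cardKF : #|K| = (#|F| ^ r)%N by rewrite cardF cardK -expnM.
have expF (x : F) : x ^+ (e * e') = x by apply: (expK_sub embF expK).
have psiFL := psiK_rel_trace embL pL (isT : (0 < 2)%N) cardFL.
have psiKF := psiK_rel_trace embF pF r_gt0 cardKF.
have expDL : {morph (fun x : L => x ^+ e) : x y / x + y}.
  have fixL z : embF (embL z) ^+ (p ^ m) = embF (embL z).
    by rewrite -!rmorphXn -cardL expf_card.
  move=> x y; apply: (fmorph_inj embL); apply: (fmorph_inj embF).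
  by rewrite !(rmorphXn, rmorphD) /= addL.
have psi_exp := psiK_exp pL e_gt0 expDL.
have psiFP := psiK_add_char pF; have psiLP := psiK_add_char pL.
have W_ge0 a : 0 <= weil (@psiK F p) e a.
  have divF : #|F|.-1%:R * weil (@psiK F p) e a / (r.-root p%:R * (p ^ m)%:R) \in
    Aint.
    apply: (weil_sub_divisible r_gt0 cardKF e_gt0 e'_gt0 expK psiFP _ _ _ _ _ _
      (emb := embF)) => //.
    - exact: eq_add_char psiKF (psiK_add_char pK).
    - by rewrite dvdn_exp.
    - by rewrite expn_gt0 prime_gt0.
    - by rewrite cardFL cardL.
    by move=> b; rewrite -(eq_weil _ _ psiKF).
  rewrite (eq_weil _ _ psiFL) in divF *.
  apply: (weil_niho_ge0 cardFL e_gt0 expF psiLP psi_exp p_pr _ r_gt0).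
  - by rewrite cardL dvdn_exp.
  - by rewrite -(eq_weil _ _ psiFL) weil_Aint.
  by rewrite cardL.
have addF := weil_ge0_additive psiFP e_gt0 expF W_ge0.
move=> x y /fixF[u <-] /fixF[v <-].
by rewrite -rmorphD -!rmorphXn -rmorphD /= addF.
Qed.

(* For j in F_p^*, the automorphism zeta_p |-> zeta_p ^+ j of algC acts on W by a
   scaling a |-> t a of its argument, with t = j / j^(1/e); since W is rational and
   determines x |-> x ^+ e, this forces t = 1. *)
Lemma additive_on_prime_field :
  (forall a, weil (@psiK K p) e a \in Num.int) -> additive_on_fixed K p e 1.
Proof.
move=> intW; have p_pr := pcharf_prime pK; have psiP := psiK_add_char pK.
set psi := @psiK K p in intW psiP.
suff expn (j : nat) : (j%:R : K) ^+ e = j%:R.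
  move=> x y; rewrite expn1 => /(prime_subfieldP pK)[j ->] /(prime_subfieldP
    pK)[k ->].
  by rewrite -natrD !expn natrD.
have [pj|pj] := boolP (p %| j)%N.
  by move: pj; rewrite (dvdn_pcharf pK) => /eqP->; rewrite expr0n gtn_eqF.
have co_jp : coprime j p by rewrite coprime_sym prime_coprime.
have [nu nuP] := Qn_aut_exists co_jp.
have psiX k x : psi x ^+ k = psi (k%:R * x).
  elim: k => [|k IHk]; first by rewrite mul0r add_char0.
  by rewrite exprS IHk -(add_charD psiP) -{1}[x]mul1r -mulrDl nat1r.
have nu_psi x : nu (psi x) = psi (j%:R * x).
  by rewrite nuP ?psiX // (pcharf0 pK) mul0r add_char0.
set J : K := j%:R; have J_neq0 : J != 0 by rewrite -(dvdn_pcharf pK).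
pose c := J ^+ e'; have c_neq0 : c != 0 by rewrite expf_neq0.
have Dc : c ^+ e = J by apply: exp_cancel_inv expK J.
have [t_neq0 Dt] : J / c != 0 /\ J = J / c * c by rewrite mulf_neq0 ?invr_neq0 //
  divfK.
set t := J / c in t_neq0 Dt.
(* [nu] turns the phase into J x^e + J a x, which is (c x)^e + t a (c x). *)
have Wt a : weil psi e (t * a) = weil psi e a.
  have nuW : nu (weil psi e a) = weil psi e a.
    by have /intrP[z ->] := intW a; rewrite rmorph_int.
  rewrite -[RHS]nuW rmorph_sum -[LHS](sum_comp_inj _ (mulfI c_neq0)).
  apply: eq_bigr => x _; rewrite nu_psi exprMn Dc mulrDr; congr (psi (_ + _)).
  by rewrite -/J Dt mulrACA.
have q_neq0 : #|K|%:R != 0 :> algC by rewrite pnatr_eq0 -lt0n ltnW ?finNzRing_gt1.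
have psit y : psi (y ^+ e) = psi ((t * y) ^+ e).
  apply: (mulfI q_neq0); rewrite -!(weil_fourier _ psiP).
  rewrite -[LHS](sum_comp_inj _ (mulfI t_neq0)); apply: eq_bigr => a _.
  by rewrite Wt; rewrite mulrA [a * t]mulrC.
have /eqP : 1 - t ^+ e = 0.
  apply: (add_charM_trivial psiP) => x; rewrite -[x](exp_cancel_inv expK) mulrBl
    mul1r.
  by rewrite -exprMn (add_charD psiP) psit -(add_charD psiP) subrr add_char0.
rewrite subr_eq0 eq_sym -[X in _ == X](expr1n _ e) => /eqP/(exp_inj expK) t1.
by move: Dt; rewrite t1 mul1r => Jc; rewrite {1}Jc Dc.
Qed.

End Step.

(** For negative exponents, x^-1 = x^(q-2), with q = [#|K|]; this holds at 0 because q > 2. The same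
    bound excludes d = 0. *)
Lemma exprz_nat_exponent (K : finFieldType) (d : int) :
    (2 < #|K|)%N -> coprime `|d|%N #|K|.-1 ->
  exists2 e : nat, (0 < e)%N & coprime e #|K|.-1 /\ forall x : K, x ^ d = x ^+ e.
Proof.
move=> K_gt2; have K1_gt1 : (1 < #|K|.-1)%N by case: #|K| K_gt2 => [|[|[|n]]].
case: d => [e|m] co_d.
  exists e => //; case: e co_d => //; rewrite /coprime gcd0n => /eqP K2.
  by rewrite K2 in K1_gt1.
have Km1 : #|K|.-1 = #|K|.-2.+1 by rewrite prednK // ltnW.
exists (#|K|.-2 * m.+1)%N; first by rewrite muln_gt0 andbT -ltnS -Km1.
split=> [|x]; first by rewrite coprimeMl co_d andbT Km1 coprimenS.
rewrite NegzE -exprnN -exprVn exprM; congr (_ ^+ _).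
have [->|x_neq0] := eqVneq x 0; first by rewrite invr0 expr0n gtn_eqF // -ltnS -Km1.
apply: (mulfI x_neq0).
by rewrite mulfV // -exprS -Km1 expf_card_pred.
Qed.

(** * Weil sums with values 0, A and -A *)

Section ThreeValued.
Variables (K : finFieldType) (p e : nat) (A : algC).
Hypotheses (pK : p \in [pchar K]) (e_gt0 : (0 < e)%N) (co_e : coprime e #|K|.-1).
Local Notation W := (weil (@psiK K p) e).
Hypothesis W_val : forall a : K, a != 0 -> W a \in [:: 0; A; - A].
Hypothesis A_val : exists a, W a = A.
Local Notation q := #|K|%:R.
Let p_pr : prime p := pcharf_prime pK.
Let psiP : add_char (@psiK K p) := psiK_add_char pK.
Let V := [pred u : K | (u + 1) ^+ e == u ^+ e + 1].

Lemma three_valued_eps : exists eps : K -> int, forall a, W a = (eps a)%:~R * A.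
Proof.
have [e' _ expK] := exists_exp_inverse co_e e_gt0.
exists (fun a => if W a == 0 then 0 else if W a == A then 1 else -1) => a.
case: eqP => [->|W0]; first by rewrite mul0r.
case: eqP => [->|WA]; first by rewrite mul1r.
have [a0|/W_val] := eqVneq a 0; first by rewrite a0 (weil0 psiP expK) in W0.
by rewrite !inE => /or3P[/eqP|/eqP|/eqP->] //; rewrite mulN1r.
Qed.

(** Each value satisfies W^3 = A^2 W; summing compares the first and third moments. *)
Lemma three_valued_sqr : A ^+ 2 = (#|K| * #|V|)%:R.
Proof.
have [e' _ expK] := exists_exp_inverse co_e e_gt0.
have q_neq0 : q != 0 :> algC by rewrite pnatr_eq0 -lt0n ltnW ?finNzRing_gt1.
have W3 a : W a ^+ 3 = A ^+ 2 * W a.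
  have [->|/W_val] := eqVneq a 0; first by rewrite (weil0 psiP expK) expr0n mulr0.
  rewrite !inE => /or3P[/eqP->|/eqP->|/eqP->]; rewrite ?expr0n ?mulr0 // exprSr //.
  by rewrite sqrrN.
apply: (mulIf q_neq0).
rewrite -{1}(sum_weil psiP e_gt0) mulr_sumr -(eq_bigr _ (fun a _ => W3 a)).
by rewrite (sum_weil3 psiP e_gt0 expK) natrM [RHS]mulrAC -expr2.
Qed.

(** The first moment makes q an integer multiple of [A], so the algebraic integer [A] is
    rational. *)
Lemma three_valued_int : A \in Num.int.
Proof.
have [eps Weps] := three_valued_eps.
have intA : A \in Aint by have [a <-] := A_val; apply: weil_Aint.
apply: Cint_rat_Aint intA; have q_neq0 : q != 0 :> algC by rewrite pnatr_eq0
  -lt0n ltnW ?finNzRing_gt1.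
have := sum_weil psiP e_gt0; under eq_bigr do rewrite Weps.
rewrite -mulr_suml -rmorph_sum /=; set s := (\sum_a eps a)%R => DA.
have s_neq0 : s%:~R != 0 :> algC by apply: contraNneq q_neq0 => s0; rewrite -DA
  s0 mul0r.
by rewrite -[A](mulKf s_neq0) DA rpredM ?rpredV ?rpred_int ?rpred_nat.
Qed.

(** By the second moment A^2 divides q^2, so [A] is a power of [p] up to sign. The set [V] contains
    0 and -1, so A^2 = q [#|V|] exceeds q. *)
Lemma three_valued_pow : exists2 k, `|A| = (p ^ k)%:R & (ext_deg K p < k.*2)%N.
Proof.
have [eps Weps] := three_valued_eps; have /intrP[z Dz] := three_valued_int.
have cardK := card_pchar pK.
have [e' _ expK] := exists_exp_inverse co_e e_gt0.
have zq : (`|z| ^ 2 %| #|K| ^ 2)%N.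
  rewrite -[X in (X %| _)%N]abszX -[X in (_ %| X)%N]/(`|(#|K| ^ 2)%:Z|%N) -dvdzE.
  apply/dvdzP; exists (\sum_a eps a ^+ 2); apply: (@intr_inj algC).
  rewrite -pmulrn natrX -(sum_weil2 psiP expK) rmorphM rmorph_sum mulr_suml.
  by apply: eq_bigr => a _; rewrite Weps exprMn Dz !rmorphXn.
rewrite dvdn_pexp2r // cardK in zq.
have /(dvdn_pfactor _ _ p_pr)[k _ zk] := zq.
have DA : `|A| = (p ^ k)%:R by rewrite Dz -intr_norm -zk -abszE pmulrn.
exists k => //.
have V_gt1 : (1 < #|V|)%N.
  rewrite (cardD1 0) (cardD1 (-1)) !inE add0r expr1n expr0n gtn_eqF // add0r eqxx.
  by rewrite oppr_eq0 oner_eq0 addNr expr0n gtn_eqF // (exp_opp expK) expr1n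
    addNr eqxx.
have eqA : (p ^ k.*2 = #|K| * #|V|)%N.
  apply/eqP; rewrite -(eqr_nat algC) -three_valued_sqr -muln2 expnM natrX -DA.
  by rewrite real_normK // Dz realz.
rewrite -(ltn_exp2l _ _ (prime_gt1 p_pr)) -/(ext_deg K p) eqA -cardK.
by rewrite ltn_Pmulr // ltnW // finNzRing_gt1.
Qed.

Lemma three_valued_additive i : (2 ^ i %| ext_deg K p)%N -> additive_on_fixed K p
  e (2 ^ i).
Proof.
have [e' e'_gt0 expK] := exists_exp_inverse co_e e_gt0.
have [eps Weps] := three_valued_eps; have [k DA ltk] := three_valued_pow.
have /intrP[z Dz] := three_valued_int.
elim: i => [_|i IHi dvi].
  apply: (additive_on_prime_field pK e_gt0 expK) => a.
  by rewrite Weps rpredM ?rpred_int ?three_valued_int.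
have dvi' : (2 ^ i %| ext_deg K p)%N by apply: dvdn_trans dvi; rewrite dvdn_exp2l.
have n_gt0 : (0 < ext_deg K p)%N.
  by rewrite lt0n; apply: contraTneq (finNzRing_gt1 K) => n0; rewrite (card_pchar
    pK) -/(ext_deg K p) n0.
have Dn : ext_deg K p = ((2 ^ i).*2 * (ext_deg K p %/ 2 ^ i.+1))%N.
  by rewrite -mul2n -expnS mulnC divnK.
set r := (_ %/ _)%N in Dn; have r_gt0 : (0 < r)%N by rewrite divn_gt0 ?expn_gt0
  // dvdn_leq.
rewrite expnS mul2n; apply: (additive_on_fixed_double pK e_gt0 e'_gt0 expK _ r_gt0).
- by rewrite expn_gt0.
- by rewrite -Dn -card_pchar.
- move=> a; rewrite Weps -mulrA rpredM ?Aint_int //.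
  (* The degree is 2 (2^i r) < 2k, hence 1 + 2^i r <= k. *)
  have : `|A| / (p * (p ^ 2 ^ i) ^ r)%:R \in Aint.
    rewrite DA -natf_div ?Aint_Cnat ?natr_nat // -expnM -expnS dvdn_exp2l //.
    by move: ltk; rewrite Dn -doubleMl ltn_double.
  have /real_ge0P[_ //|_] : A \is Num.real by rewrite Dz realz.
  by rewrite mulNr rpredN.
exact: IHi.
Qed.

(** [V] contains the subfield of order p^(2^s), with s the 2-adic valuation of the degree. The
    factor p^(2^(s-1)) is written as a square root, which covers s = 0. *)
Lemma three_valued_bound :
  sqrtC ((p ^ (2 ^ logn 2 (ext_deg K p)))%:R) * sqrtC q <= `|A|.
Proof.
set m := (2 ^ _)%N; have mn : (m %| ext_deg K p)%N by apply: pfactor_dvdnn.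
have cardK := card_pchar pK; rewrite -/(ext_deg K p) -(divnK mn) mulnC in cardK.
have Vm : (p ^ m <= #|V|)%N.
  rewrite -(card_frobn_fixed pK _ cardK) ?expn_gt0 //; apply: subset_leq_card.
  apply/subsetP=> u; rewrite !inE => /eqP fu.
  by rewrite (three_valued_additive mn) ?expr1n.
rewrite -rootCMl ?ler0n // -natrM.
rewrite -(ler_pXn2r (isT : (0 < 2)%N)) ?nnegrE ?normr_ge0 ?sqrtC_ge0 ?ler0n //.
rewrite sqrtCK real_normK; last by have /intrP[z ->] := three_valued_int; apply:
  realz.
by rewrite three_valued_sqr ler_nat mulnC leq_mul2l Vm orbT.
Qed.

End ThreeValued.

Theorem theorem1p7 (K : finFieldType) (p : nat) (d : int) (A : algC) :
  p \in [pchar K] ->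
  coprime `|d|%N (#|K|.-1) ->
  (forall z : algC,
     (exists2 a : K, a != 0 & weil_sum p d a = z) <-> z \in [:: 0; A; - A]) ->
  uniq [:: 0; A; - A] ->
  sqrtC ((p ^ (2 ^ logn 2 (ext_deg K p)))%:R) * sqrtC (#|K|%:R) <= `|A|.
Proof.
move=> pK co_d W_val; rewrite /= !inE !negb_or -!andbA => /and4P[A_neq0 _ _ _].
have [a0 a0_neq0 Wa0] : exists2 a : K, a != 0 & weil_sum p d a = 0.
  by apply/W_val; rewrite !inE eqxx.
have [a1 a1_neq0 Wa1] : exists2 a : K, a != 0 & weil_sum p d a = A.
  by apply/W_val; rewrite !inE eqxx orbT.
(* With two elements there is a single nonzero [a], which cannot give both values 0 and [A]. *)
have K_gt2 : (2 < #|K|)%N.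
  rewrite ltn_neqAle finNzRing_gt1 andbT; apply: contraNneq A_neq0 => K2.
  have a1E : forall a : K, a != 0 -> a = 1.
    by move=> a /expf_card_pred; rewrite -K2 expr1.
  by rewrite -Wa1 -Wa0 (a1E a0) // (a1E a1).
have [e e_gt0 [co_e De]] := exprz_nat_exponent K_gt2 co_d.
have WE a : weil_sum p d a = weil (@psiK K p) e a.
  by apply: eq_bigr => x _; rewrite De.
apply: (three_valued_bound pK e_gt0 co_e) => [a a_neq0|].
  by rewrite -WE; apply/W_val; exists a.
by exists a1; rewrite -WE.
Qed.
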